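(* Assume we have a finite-dimensional Lie algebra $\mathfrak{g}$ and a symmetric invariant bilinear form $\beta$ on $\mathfrak{g}$. For the family $\overline{\mathcal{G}}_{(e_1,e_2)}$ of current algebras containing the classical current algebra $\overline{\mathfrak{g}}$ as special element, a family of almost-graded central extensions $\widehat{\mathcal{G}}_{(e_1,e_2)}$, i.e. a family of higher genus affine Lie algebras containing the classical affine Lie algebra $\widehat{\mathfrak{g}}$ (with respect to the form $\beta$) as special element, is given via the geometric two-cocycle. It calculates as $$\gamma(x\otimes A_n,y\otimes A_m)=p(e_1,e_2)\cdot\beta(x,y)\cdot\frac{1}{2\pi\mathrm{i}}\int_{C_S}A_n\,dA_m$$ with $$\frac{1}{2\pi\mathrm{i}}\int_{C_S}A_n\,dA_m=\begin{cases}-n\,\delta_m^{-n},& n,m\text{ even},\\ 0,& n,m\text{ of different parity},\\ -n\,\delta_m^{-n}+3e_1(-n+1)\,\delta_m^{-n+2}+(e_1-e_2)(2e_1+e_2)(-n+2)\,\delta_m^{-n+4},& n,m\text{ odd}.\end{cases}$$ Here $p(e_1,e_2)$ is an arbitrary polynomial in the variables $e_1$ and $e_2$.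
   Context: All Lie algebras are over $\mathbb{C}$; $x,y\in\mathfrak{g}$, $n,m\in\mathbb{Z}$, $(e_1,e_2)\in\mathbb{C}^2$. Invariance of $\beta$ means $\beta([x,y],z)=\beta(x,[y,z])$ for all $x,y,z\in\mathfrak{g}$. $\delta_m^{k}$ is $1$ if $m=k$ and $0$ otherwise. $\overline{\mathcal{G}}_{(e_1,e_2)}$ is the Lie algebra on $\mathfrak{g}\otimes V$, where $V$ has basis $\{A_n\mid n\in\mathbb{Z}\}$, with bracket $[x\otimes A_n,y\otimes A_m]=[x,y]\otimes A_{n+m}$ for $n$ or $m$ even, and $[x\otimes A_n,y\otimes A_m]=[x,y]\otimes A_{n+m}+3e_1[x,y]\otimes A_{n+m-2}+(e_1-e_2)(2e_1+e_2)[x,y]\otimes A_{n+m-4}$ for $n$ and $m$ both odd. The special element is at $(e_1,e_2)=(0,0)$: with $A_n=z^n$ it is the classical current algebra $\overline{\mathfrak{g}}=\mathfrak{g}\otimes\mathbb{C}[z^{-1},z]$. If $e_1,e_2,e_3:=-(e_1+e_2)$ are pairwise distinct, then $\overline{\mathcal{G}}_{(e_1,e_2)}=\mathfrak{g}\otimes\mathcal{A}_{(e_1,e_2)}$ with bracket $[x\otimes f,y\otimes g]=[x,y]\otimes fg$, where $\mathcal{A}_{(e_1,e_2)}$ is the algebra of meromorphic functions on the elliptic curve with affine equation $Y^2=4(X-e_1)(X-e_2)(X-e_3)$ that are holomorphic outside $(e_1,0)$ and $\infty$, with basis $A_{2k}=(X-e_1)^k$, $A_{2k+1}=\tfrac12Y(X-e_1)^{k-1}$,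 $k\in\mathbb{Z}$. $C_S$ is a cycle separating the two marked points $(e_1,0)$ and $\infty$, and the integral over it is computed by the residue at $(e_1,0)$, or by minus the residue at $\infty$. For the remaining (singular) values of $(e_1,e_2)$ the cocycle is obtained by specializing $e_1,e_2$ in the displayed formula. The geometric two-cocycle on $\mathfrak{g}\otimes\mathcal{A}$ is the one in the bracket $[\widehat{x\otimes f},\widehat{y\otimes g}]=\widehat{[x,y]\otimes(fg)}+\beta(x,y)\,\frac{1}{2\pi\mathrm{i}}\int_{C_S}f\,dg\cdot t$, $[t,\widehat{\mathcal{G}}]=0$, on $\widehat{\mathcal{G}}=\mathbb{C}\oplus\overline{\mathcal{G}}$, where $\widehat{x\otimes f}=(0,x\otimes f)$ and $t=(1,0)$; the algebras $\widehat{\mathcal{G}}$ are called higher genus affine algebras. The central extension given by a two-cocycle $\gamma$ has bracket $[\widehat a,\widehat b]=\widehat{[a,b]}+\gamma(a,b)\,t$ with $t$ central; a two-cocycle is an antisymmetric bilinear form with $\gamma([a,b],c)+\gamma([b,c],a)+\gamma([c,a],b)=0$. The classical affine Lie algebra is $\widehat{\mathfrak{g}}=\overline{\mathfrak{g}}\oplus\mathbb{C}t$ with bracket $[x\otimes z^n,y\otimes z^m]=[x,y]\otimes z^{n+m}-\beta(x,y)\,n\,\delta_m^{-n}\,t$ and $t$ central. An algebra $\mathcal{B}=\bigoplus_{n\in\mathbb{Z}}\mathcal{B}_n$ (direct decomposition as a vector space) is almost-graded if $\dim\mathcal{B}_n<\infty$ for all $n$ and there are constants $R,S$ with $\mathcal{B}_n\cdot\mathcal{B}_m\subseteq\bigoplus_{h=n+m+R}^{n+m+S}\mathcal{B}_h$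 for all $n,m\in\mathbb{Z}$. Here $\deg(x\otimes A_n)=n$ and $\deg t=1$ (or any other fixed value).
   Formalization: That the family contains the classical affine algebra at (0,0) is claimed only when p(0,0) is nonzero (equal if p(0,0)=1, otherwise isomorphic by rescaling t); for p(0,0)=0 and nonzero β the member at (0,0) is the split extension, so the claim fails for arbitrary p. *)

(* Defs.v *)
From HB Require Import structures.
From mathcomp Require Import all_boot all_order all_algebra.
From mathcomp Require Import complex ring lra zify.
From mathcomp Require Import all_classical all_reals all_analysis.
Import Order.TTheory GRing.Theory Num.Theory.
Import numFieldNormedType.Exports.

Set Implicit Arguments.
Unset Strict Implicit.
Unset Printing Implicit Defensive.

Local Open Scope classical_set_scope.
Local Open Scope complex_scope.
Local Open Scope ring_scope.

(* Finitely supported families [int -> V].  For V = g this is g (x) V with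
   basis (A_n) of the second factor: the family u stands for
   \sum_n u_n (x) A_n.  For V = C it is the space with basis (A_n) itself. *)
Section FinFam.
Variables (K : fieldType) (V : lmodType K).

Definition finsupp : {pred int -> V} :=
  fun f => `[< finite_set [set n | f n != 0] >].

Lemma finsupp_submod_closed : submod_closed finsupp.
Proof.
split=> [|a f h]; rewrite !unfold_in.
  apply/asboolP; apply: (@sub_finite_set _ _ set0) => // n /=.
  by rewrite eqxx.
move=> /asboolP ff /asboolP fh; apply/asboolP.
apply: (@sub_finite_set _ _ ([set n | f n != 0] `|` [set n | h n != 0])).
  move=> n /=; rewrite -[(a *: f + h) n]/(a *: f n + h n).
  have [->|] := eqVneq (f n) 0; last by left.
  by rewrite scaler0 add0r => ?; right.
by rewrite finite_setU.
Qed.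

HB.instance Definition _ :=
  GRing.isSubmodClosed.Build K (int -> V) finsupp finsupp_submod_closed.

Record finfam := FinFam { finfam_val :> int -> V; _ : finfam_val \in finsupp }.

HB.instance Definition _ := [isSub of finfam for finfam_val].
HB.instance Definition _ := [Choice of finfam by <:].
HB.instance Definition _ := [SubChoice_isSubLmodule of finfam by <:].

Lemma single_finsupp (x : V) (n : int) :
  (fun k => if k == n then x else 0) \in finsupp.
Proof.
rewrite unfold_in; apply/asboolP; apply: (@sub_finite_set _ _ [set n]) => //.
by move=> k /=; case: (k =P n) => // _; rewrite eqxx.
Qed.

(* x (x) A_n *)
Definition single (x : V) (n : int) : finfam := FinFam (single_finsupp x n).

Lemma scale_finsupp (x : V) (a : int -> K) :
  finite_set [set n | a n != 0] -> (fun n => a n *: x) \in finsupp.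
Proof.
move=> fa; rewrite unfold_in; apply/asboolP; apply: sub_finite_set fa.
by move=> n /=; apply: contra_neq => ->; rewrite scale0r.
Qed.

(* Bilinear extension of a prescription F x n y m, bilinear in (x, y), for the
   value on (x (x) A_n, y (x) A_m). *)
Definition bilext (W : lmodType K) (F : V -> int -> V -> int -> W)
    (u v : finfam) : W :=
  \sum_(n \in [set: int]) \sum_(m \in [set: int]) F (u n) n (v m) m.

End FinFam.

Section LieAlgebras.
Variable K : fieldType.

Definition bilinear_map (U V W : lmodType K) (f : U -> V -> W) : Prop :=
  (forall v, linear (f ^~ v)) /\ (forall u, linear (f u)).

Definition lie_algebra (L : lmodType K) (br : L -> L -> L) : Prop :=
  [/\ bilinear_map br,
      forall x, br x x = 0 &
      forall x y z, br x (br y z) + br y (br z x) + br z (br x y) = 0].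

Definition lie_symmetric (L : lmodType K) (b : L -> L -> K^o) : Prop :=
  forall x y, b x y = b y x.

Definition lie_invariant (L : lmodType K) (br : L -> L -> L)
    (b : L -> L -> K^o) : Prop :=
  forall x y z, b (br x y) z = b x (br y z).

Definition two_cocycle (L : lmodType K) (br : L -> L -> L)
    (c : L -> L -> K^o) : Prop :=
  [/\ bilinear_map c,
      forall a b, c a b = - c b a &
      forall x y z, c (br x y) z + c (br y z) x + c (br z x) y = 0].

(* The bracket on K (+) L given by the cocycle c: the hat of a is (0, a). *)
Definition ext_bracket (L : lmodType K) (br : L -> L -> L)
    (c : L -> L -> K^o) (a b : K^o * L) : K^o * L :=
  (c a.2 b.2, br a.2 b.2).

Definition central_elt (L : lmodType K) : K^o * L := (1, 0).

Definition central (L : lmodType K) (br : L -> L -> L) (t : L) : Prop :=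
  forall a, br t a = 0 /\ br a t = 0.

Definition lie_isomorphism (L M : lmodType K) (brL : L -> L -> L)
    (brM : M -> M -> M) (phi : L -> M) : Prop :=
  [/\ linear phi, bijective phi &
      forall a b, phi (brL a b) = brM (phi a) (phi b)].

Definition subspace (B : lmodType K) (S : set B) : Prop :=
  S 0 /\ forall (a : K) u v, S u -> S v -> S (a *: u + v).

Definition finite_dim (B : lmodType K) (S : set B) : Prop :=
  exists s : seq B, forall b, S b ->
    exists a : 'I_(size s) -> K, b = \sum_(i < size s) a i *: s`_i.

Definition direct_decomposition (B : lmodType K) (Bn : int -> set B) : Prop :=
  (forall n, subspace (Bn n)) /\
  (forall b, exists! c : finfam B,
     (forall n, Bn n (c n)) /\ b = \sum_(n \in [set: int]) c n).

Definition almost_graded (B : lmodType K) (op : B -> B -> B)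
    (Bn : int -> set B) : Prop :=
  [/\ direct_decomposition Bn,
      forall n, finite_dim (Bn n) &
      exists R S : int, forall (n m : int) u v, Bn n u -> Bn m v ->
        exists c : finfam B,
          [/\ forall h, Bn h (c h),
              forall h, c h != 0 -> n + m + R <= h <= n + m + S &
              op u v = \sum_(h \in [set: int]) c h]].

End LieAlgebras.

Section Family.
Variable R : realType.
Local Notation C := R[i].

Definition oddz (n : int) : bool := odd `|n|%N.

Definition kron (n m : int) : C := (n == m)%:R.

Definition e3 (e1 e2 : C) : C := - (e1 + e2).

Definition nonsingular (e1 e2 : C) : Prop :=
  [/\ e1 != e2, e1 != e3 e1 e2 & e2 != e3 e1 e2].

(* Affine part of the elliptic curve; P = (e1, 0) is one of the two marked
   points, the other one is the point at infinity. *)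
Definition on_curve (e1 e2 : C) (Q : C * C) : Prop :=
  Q.2 ^+ 2 = 4%:R * (Q.1 - e1) * (Q.1 - e2) * (Q.1 - e3 e1 e2).

(* The function A_n; (n %/ 2)%Z is the floor, so n = 2k or n = 2k + 1. *)
Definition basis_fun (e1 : C) (n : int) (Q : C * C) : C :=
  let k := (n %/ 2)%Z in
  if oddz n then 2%:R^-1 * Q.2 * (Q.1 - e1) ^ (k - 1) else (Q.1 - e1) ^ k.

(* The element \sum_n a_n A_n of the function algebra. *)
Definition alg_fun (e1 : C) (a : finfam C^o) (Q : C * C) : C :=
  \sum_(n \in [set: int]) a n * basis_fun e1 n Q.

Definition cis (t : R) : C := cos t +i* sin t.

Definition cder (h : R -> C) (t : R) : C :=
  derive1 (fun s => complex.Re (h s)) t +i* derive1 (fun s => complex.Im (h s)) t.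

Definition cint (a b : R) (h : R -> C) : C :=
  (\int[lebesgue_measure]_(t in `[a, b]) complex.Re (h t)) +i*
  (\int[lebesgue_measure]_(t in `[a, b]) complex.Im (h t)).

(* (1 / 2 pi i) times the integral of f dg along the path c on [0, 2 pi] *)
Definition contour (c : R -> C * C) (f g : C * C -> C) : C :=
  (2%:R * pi%:C * (0 +i* 1))^-1 *
  cint 0 (2%:R * pi) (fun t => f (c t) * cder (g \o c) t).

Definition path_continuous (h : R -> C) : Prop :=
  continuous (fun t => complex.Re (h t) : R) /\
  continuous (fun t => complex.Im (h t) : R).

(* The cycle C_S: a lift to the curve of the circle |X - e1| = rho traversed
   twice counterclockwise.  If rho is smaller than |e2 - e1| and |e3 - e1|
   the cycle bounds a disc around (e1, 0), positively oriented, and [contour]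
   is the residue at (e1, 0); if rho is larger than both, it bounds a disc
   around infinity, negatively oriented, and [contour] is minus the residue at
   infinity. *)
Definition separating_cycle (e1 e2 : C) (c : R -> C * C) : Prop :=
  exists rho : R,
    [/\ 0 < rho,
        (rho%:C < `|e2 - e1| /\ rho%:C < `|e3 e1 e2 - e1|) \/
        (`|e2 - e1| < rho%:C /\ `|e3 e1 e2 - e1| < rho%:C),
        forall t, (c t).1 = e1 + rho%:C * cis (2%:R * t),
        forall t, on_curve e1 e2 (c t) &
        path_continuous (fun t => (c t).2)].

(* The displayed right-hand side for (1 / 2 pi i) \int A_n dA_m. *)
Definition pairing (e1 e2 : C) (n m : int) : C :=
  if oddz n != oddz m then 0
  else if oddz n then
    - n%:~R * kron m (- n)
    + 3%:R * e1 * (- n + 1)%:~R * kron m (- n + 2)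
    + (e1 - e2) * (2%:R * e1 + e2) * (- n + 2)%:~R * kron m (- n + 4)
  else - n%:~R * kron m (- n).

Variables (g : vectType C) (lb : g -> g -> g) (beta : g -> g -> C^o).
Local Notation G := (finfam g).

(* x (x) f for f = \sum_n a_n A_n *)
Definition tensor (x : g) (a : finfam C^o) : G :=
  FinFam (scale_finsupp x (asboolW (valP a))).

Definition current_bracket (e1 e2 : C) : G -> G -> G :=
  bilext (fun x n y m =>
    if oddz n && oddz m then
      single (lb x y) (n + m)
      + single ((3%:R * e1) *: lb x y) (n + m - 2)
      + single (((e1 - e2) * (2%:R * e1 + e2)) *: lb x y) (n + m - 4)
    else single (lb x y) (n + m)).

Definition classical_current_bracket : G -> G -> G :=
  bilext (fun x n y m => single (lb x y) (n + m)).

Definition classical_affine_bracket : C^o * G -> C^o * G -> C^o * G :=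
  ext_bracket classical_current_bracket
    (bilext (fun x n y m => - (beta x y * n%:~R * kron m (- n)) : C^o)).

(* p (e1, e2): the outer variable of p is the first one *)
Definition eval2 (p : {poly {poly C}}) (e1 e2 : C) : C := p.[e1%:P].[e2].

(* gamma for all (e1, e2); at singular parameters this is the specialization
   of the displayed formula. *)
Definition cocycle (p : {poly {poly C}}) (e1 e2 : C) : G -> G -> C^o :=
  bilext (fun x n y m =>
    eval2 p e1 e2 * beta x y * pairing e1 e2 n m : C^o).

Definition family_bracket (p : {poly {poly C}}) (e1 e2 : C) :
    C^o * G -> C^o * G -> C^o * G :=
  ext_bracket (current_bracket e1 e2) (cocycle p e1 e2).

(* c is the geometric two-cocycle: c (x (x) f, y (x) g) is
   beta (x, y) (1 / 2 pi i) \int_{C_S} f dg for all f, g in the algebra. *)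
Definition geometric_cocycle (e1 e2 : C) (c : G -> G -> C^o) : Prop :=
  bilinear_map c /\
  forall cyc, separating_cycle e1 e2 cyc ->
  forall (x y : g) (a b : finfam C^o),
    c (tensor x a) (tensor y b) =
    beta x y * contour cyc (alg_fun e1 a) (alg_fun e1 b).

(* Homogeneous subspace of degree n for deg (x (x) A_n) = n, deg t = d. *)
Definition ext_degree (d n : int) : set (C^o * G) :=
  [set w | (n != d -> w.1 = 0) /\ exists x, w.2 = single x n].

End Family.

(* Multiplication table of the functions A_n and existence of the cycle: for
   nonsingular parameters [current_bracket] is the bracket of g (x) A, and the
   quantification over cycles in [geometric_cocycle] is not vacuous. *)
Section CurveFacts.
Variable R : realType.
Local Notation C := R[i].

Lemma oddz_eq (n : int) : n = 2 * (n %/ 2)%Z + (oddz n)%:Z.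
Proof. by rewrite /oddz; lia. Qed.

Lemma oddzD (n m : int) : oddz (n + m) = oddz n (+) oddz m.
Proof. by rewrite /oddz; lia. Qed.

Lemma oddz_shift (n : int) : (oddz (n - 2) = oddz n) * (oddz (n - 4) = oddz n).
Proof. by split; rewrite /oddz; lia. Qed.

Lemma basis_fun_mul (e1 e2 : C) (n m : int) (Q : C * C) :
  on_curve e1 e2 Q -> Q.1 != e1 ->
  basis_fun e1 n Q * basis_fun e1 m Q =
  if oddz n && oddz m then
    basis_fun e1 (n + m) Q
    + 3%:R * e1 * basis_fun e1 (n + m - 2) Q
    + (e1 - e2) * (2%:R * e1 + e2) * basis_fun e1 (n + m - 4) Q
  else basis_fun e1 (n + m) Q.
Proof.
case: Q => X Y; rewrite /on_curve /e3 /= => hY; rewrite -subr_eq0 => zN0.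
have zD : {morph (fun k : int => (X - e1) ^ k) : a b / a + b >-> a * b}.
  by move=> a b; rewrite /= expfzDr.
rewrite /basis_fun /= !oddz_shift !oddzD.
have [hn hm] := (oddz_eq n, oddz_eq m).
case: (oddz n) hn; case: (oddz m) hm => /= hm hn.
- rewrite (_ : ((n + m) %/ 2)%Z = (n %/ 2)%Z - 1 + ((m %/ 2)%Z - 1) + 3%N); last by lia.
  rewrite (_ : ((n + m - 2) %/ 2)%Z = (n %/ 2)%Z - 1 + ((m %/ 2)%Z - 1) + 2%N); last by lia.
  rewrite (_ : ((n + m - 4) %/ 2)%Z = (n %/ 2)%Z - 1 + ((m %/ 2)%Z - 1) + 1%N); last by lia.
  rewrite !zD -!exprnP.
  move: (_ ^ (n %/ 2)%Z) (_ ^ (m %/ 2)%Z) (_ ^ (- 1)) => a b c.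
  transitivity (b * c * (a * c) * (4%:R^-1 * Y ^+ 2)); first by field.
  by rewrite hY; field.
- by rewrite -[LHS]mulrA -expfzDr//; congr (_ * _ ^ _); lia.
- by rewrite mulrCA -expfzDr//; congr (_ * _ ^ _); lia.
- by rewrite -expfzDr//; congr (_ ^ _); lia.
Qed.
Lemma path_continuous_cst (z : C) : path_continuous (fun=> z).
Proof. by split; apply: cst_continuous. Qed.

Lemma path_continuous_mul (f h : R -> C) : path_continuous f -> path_continuous h -> path_continuous (fun t => f t * h t).
Proof.
move=> [f1 f2] [h1 h2]; split.
  rewrite (_ : (fun t => _) = fun t => complex.Re (f t) * complex.Re (h t)
     - complex.Im (f t) * complex.Im (h t)); last first.
    by apply/funext => t; case: (f t) (h t) => ? ? [? ?].
  by move=> t; apply: cvgB; apply: cvgM; [exact: f1|exact: h1|exact: f2|exact: h2].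
rewrite (_ : (fun t => _) = fun t => complex.Re (f t) * complex.Im (h t)
   + complex.Im (f t) * complex.Re (h t)); last first.
  by apply/funext => t; case: (f t) (h t) => ? ? [? ?].
by move=> t; apply: cvgD; apply: cvgM; [exact: f1|exact: h2|exact: f2|exact: h1].
Qed.

Lemma path_continuous_add (f h : R -> C) : path_continuous f -> path_continuous h -> path_continuous (fun t => f t + h t).
Proof.
move=> [f1 f2] [h1 h2]; split.
  rewrite (_ : (fun t => _) = fun t => complex.Re (f t) + complex.Re (h t)); last first.
    by apply/funext => t; case: (f t) (h t) => ? ? [? ?].
  by move=> t; apply: cvgD; [exact: f1|exact: h1].
rewrite (_ : (fun t => _) = fun t => complex.Im (f t) + complex.Im (h t)); last first.
  by apply/funext => t; case: (f t) (h t) => ? ? [? ?].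
by move=> t; apply: cvgD; [exact: f2|exact: h2].
Qed.

Lemma path_continuous_cis : path_continuous (@cis R).
Proof. by split; [exact: continuous_cos|exact: continuous_sin]. Qed.

Lemma cis_double (t : R) : cis (2%:R * t) = cis t ^+ 2.
Proof.
rewrite expr2 /cis -[2%:R * t]/((1 + 1) * t) mulrDl mul1r cosD sinD.
by apply/eqP; rewrite eq_complex /= eqxx /= addrC eqxx.
Qed.

Lemma normc_cis (t : R) : `|cis t| = 1.
Proof. by rewrite normc_def /cis /= cos2Dsin2 sqrtr1. Qed.

Lemma csqrt_lift (h : R -> C) : path_continuous h -> (forall t, 0 < complex.Re (h t)) ->
  exists s : R -> C, path_continuous s /\ forall t, s t ^+ 2 = h t.
Proof.
move=> [h1 h2] h0.
pose n t := Num.sqrt (complex.Re (h t) ^+ 2 + complex.Im (h t) ^+ 2).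
pose r t := Num.sqrt ((n t + complex.Re (h t)) / 2%:R).
have rgt0 t : 0 < r t.
  by rewrite sqrtr_gt0 divr_gt0// ltr_wpDl// sqrtr_ge0.
have cn : continuous n.
  move=> t; apply: (@continuous_comp _ _ _ (fun t => complex.Re (h t) ^+ 2 + complex.Im (h t) ^+ 2)); last exact: sqrt_continuous.
  by apply: cvgD; apply: cvgM; [exact: h1|exact: h1|exact: h2|exact: h2].
have cr : continuous r.
  move=> t; apply: (@continuous_comp _ _ _ (fun t => (n t + complex.Re (h t)) / 2%:R)); last exact: sqrt_continuous.
  by apply: cvgM; [apply: cvgD; [exact: cn|exact: h1]|exact: cvg_cst].
exists (fun t => r t +i* (complex.Im (h t) / (2%:R * r t))); split.
  split=> [|t] /=; first exact: cr.
  apply: cvgM; first exact: h2.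
  apply: cvgV; first by rewrite mulf_neq0// gt_eqF.
  by apply: cvgM; [exact: cvg_cst|exact: cr].
move=> t; have := rgt0 t; have : r t ^+ 2 = (n t + complex.Re (h t)) / 2%:R.
  by rewrite sqr_sqrtr// divr_ge0// addr_ge0 ?sqrtr_ge0 ?ltW.
have : n t ^+ 2 = complex.Re (h t) ^+ 2 + complex.Im (h t) ^+ 2.
  by rewrite sqr_sqrtr// addr_ge0 ?sqr_ge0.
have : 0 <= n t by exact: sqrtr_ge0.
move: (h0 t); case: (h t) => a b /= a0; move: (n t) (r t) => N q N0 N2 q2 q0.
have qN0 : q != 0 by rewrite gt_eqF.
rewrite expr2; apply/eqP; rewrite eq_complex /=; apply/andP; split; apply/eqP.
  have -> : b / (2%:R * q) * (b / (2%:R * q)) = b ^+ 2 / (4%:R * q ^+ 2) by field.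
  have -> : b ^+ 2 = N ^+ 2 - a ^+ 2 by rewrite N2 addrC addKr.
  rewrite -expr2 q2; field.
  by rewrite gt_eqF//; lra.
by field.
Qed.

Lemma separating_cycle_exists (e1 e2 : C) :
  nonsingular e1 e2 -> exists c, separating_cycle e1 e2 c.
Proof.
move=> [e12 e13 _].
have lift (e : C) (rho : R) : 0 < rho -> e1 != e -> rho%:C < `|e - e1| ->
    exists s, path_continuous s /\
      forall t, (e1 - e) * s t ^+ 2 = e1 + rho%:C * cis (2%:R * t) - e.
  move=> r0 e1e rlt.
  have dN0 : e1 - e != 0 by rewrite subr_eq0.
  have [|t|s [cs sE]] := @csqrt_lift (fun t => 1 + rho%:C / (e1 - e) * cis t ^+ 2).
  - apply: path_continuous_add; first exact: path_continuous_cst.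
    apply: path_continuous_mul; first exact: path_continuous_cst.
    by apply: path_continuous_mul; exact: path_continuous_cis.
  - set w := (X in 1 + X).
    have : `|w| < 1.
      rewrite normrM normrX normc_cis expr1n mulr1 normf_div distrC.
      rewrite ltr_pdivrMr ?normr_gt0 ?subr_eq0 1?eq_sym// mul1r gtr0_norm//.
      by rewrite ltcR.
    case: w => x y; rewrite normc_def /= ltcR => xy1.
    have : `|x| < 1.
      apply: le_lt_trans xy1; rewrite -sqrtr_sqr ler_wsqrtr// lerDl sqr_ge0 //.
    by rewrite ltr_norml => /andP[]; lra.
  - exists s; split=> // t; rewrite sE cis_double; field.
    by [].
pose d2 := complex.Re `|e2 - e1|; pose d3 := complex.Re `|e3 e1 e2 - e1|.
have d2E : `|e2 - e1| = d2%:C by rewrite /d2 normc_def.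
have d3E : `|e3 e1 e2 - e1| = d3%:C by rewrite /d3 normc_def.
have d20 : 0 < d2 by rewrite -ltcR -d2E normr_gt0 subr_eq0 eq_sym.
have d30 : 0 < d3 by rewrite -ltcR -d3E normr_gt0 subr_eq0 eq_sym.
pose rho := d2 * d3 / (d2 + d3).
have r0 : 0 < rho by rewrite divr_gt0 ?mulr_gt0 ?addr_gt0.
have r2 : rho%:C < `|e2 - e1|.
  by rewrite d2E ltcR ltr_pdivrMr ?addr_gt0// ltr_pM2l// ltrDr.
have r3 : rho%:C < `|e3 e1 e2 - e1|.
  by rewrite d3E ltcR ltr_pdivrMr ?addr_gt0// mulrC ltr_pM2l// ltrDl.
have [s2 [cs2 s2E]] := lift _ _ r0 e12 r2.
have [s3 [cs3 s3E]] := lift _ _ r0 e13 r3.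
pose k := sqrtc ((e1 - e2) * (e1 - e3 e1 e2)).
exists (fun t => (e1 + rho%:C * cis (2%:R * t),
  2%:R * k * (Num.sqrt rho)%:C * (cis t * (s2 t * s3 t)))).
exists rho; split => //=.
- by left.
- move=> t; rewrite /on_curve /= -s2E -s3E cis_double.
  have k2 : k ^+ 2 = (e1 - e2) * (e1 - e3 e1 e2) by rewrite sqr_sqrtc.
  have q2 : (Num.sqrt rho)%:C ^+ 2 = rho%:C.
    by rewrite -rmorphXn /= sqr_sqrtr// ltW.
  rewrite -q2 !exprMn k2; ring.
- apply: path_continuous_mul; first exact: path_continuous_cst.
  apply: path_continuous_mul; first exact: path_continuous_cis.
  exact: path_continuous_mul.
Qed.
End CurveFacts.

(* Main.v *)
Require Import Defs.
From HB Require Import structures.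
From mathcomp Require Import all_boot all_order all_algebra.
From mathcomp Require Import finmap.
From mathcomp Require Import complex ring lra zify.
From mathcomp Require Import all_classical all_reals all_analysis.
Import Order.TTheory GRing.Theory Num.Theory.
Import numFieldNormedType.Exports.

(** Every map in sight is bilinear, so an identity between elements
    \sum_n u_n (x) A_n is checked on the elements x (x) A_n ([bilinear_ext],
    and [cyclic_trilinear0] for the Jacobi and cocycle identities).

    Put a = 3 e1 and b = (e1 - e2) (2 e1 + e2).  The multiplication table
    A_n A_m = A_(n+m), with the lower terms a A_(n+m-2) + b A_(n+m-4) when n
    and m are odd, is associative for all (e1, e2): a product A_n A_m A_k has
    the lower terms exactly when two of n, m, k are odd, which is symmetric in
    the three indices.  This gives the Jacobi identity
    ([current_bracket_triple]).  By symmetry and invariance of beta, the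
    cocycle identity amounts to the vanishing of the cyclic sum of the
    pairings of A_n A_m with A_k; this is the combinatorial form of
    \int d(A_n A_m A_k) = 0 and also holds for all (e1, e2)
    ([pairing_cyclic]).  Almost-grading is then visible on the formulas: the
    bracket of degrees n and m lives in degrees n + m, n + m - 2, n + m - 4,
    and the cocycle vanishes unless n + m is 0, 2 or 4.

    The integrals are computed on the path itself.  With z = X - e1, the cycle
    is z = rho e^(2it) for t in [0, 2 pi], so z^k has derivative 2ik z^k and
    integrates to 0 unless k = 0 ([cint_circle_pow]).  The curve is
    Y^2 = 4 (z^3 + a z^2 + b z).  If n and m have the same parity, A_n dA_m
    involves Y only through Y^2 and Y dY = d(Y^2) / 2; it is a Laurent
    polynomial in z, and the displayed formula is read off its constant term
    ([contour_basis]).  The circle being run through twice accounts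
    for the factor 2 in n = 2k.  If the parities differ, the integrand is an
    odd function of Y.  After one turn, t |-> t + pi, the coordinate z is back
    where it was and Y has changed sign: Y is e^(it) (small circle) or e^(3it)
    (large circle) times a function of period pi
    ([separating_cycle_coordinates]).  So the two turns cancel
    ([cint_antiperiodic]).

    The integral is bilinear in the two functions, so these values determine
    it on the whole function algebra ([cocycle_geometric]).  As a separating
    cycle exists and the x (x) A_n span, the geometric cocycle is unique
    ([geometric_cocycle_unique]).  At (0, 0) one has a = b = 0, and both the
    bracket and the cocycle become the classical ones, the latter up to the
    factor p(0, 0). *)

Set Implicit Arguments.
Unset Strict Implicit.
Unset Printing Implicit Defensive.

Local Open Scope classical_set_scope.
Local Open Scope complex_scope.
Local Open Scope ring_scope.

(** * Linear maps and finitely supported families *)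

Section LinearMaps.
Variable K : fieldType.

(** Bilinear maps are given here by unbundled predicates; these are the
    corresponding forms of the usual rules for linear maps. *)
Lemma linear_map0 (U W : lmodType K) (f : U -> W) : linear f -> f 0 = 0.
Proof.
by move=> lf; rewrite -[in LHS](addNr 0) -scaleN1r lf scaleN1r addNr.
Qed.

Lemma linear_mapD (U W : lmodType K) (f : U -> W) :
  linear f -> {morph f : x y / x + y}.
Proof. by move=> lf x y; rewrite -[x in LHS]scale1r lf scale1r. Qed.

Lemma linear_mapZ (U W : lmodType K) (f : U -> W) :
  linear f -> forall a, {morph f : x / a *: x}.
Proof.
by move=> lf a x; rewrite -[a *: x in LHS]addr0 lf (linear_map0 lf) addr0.
Qed.

Lemma linear_mapN (U W : lmodType K) (f : U -> W) :
  linear f -> {morph f : x / - x}.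
Proof. by move=> lf x; rewrite -scaleN1r (linear_mapZ lf) scaleN1r. Qed.

Lemma linear_map_sum (U W : lmodType K) (f : U -> W) (I : Type) (s : seq I)
    (u : I -> U) :
  linear f -> f (\sum_(i <- s) u i) = \sum_(i <- s) f (u i).
Proof.
by move=> lf; apply: (big_morph f (linear_mapD lf) (linear_map0 lf)).
Qed.

End LinearMaps.

Section FinitelySupported.
Variable K : fieldType.

Definition supported (V : lmodType K) (u : finfam V) (A : {fset int}) : Prop :=
  forall n, n \notin A -> u n = 0.

Lemma supported_ex (V : lmodType K) (u : finfam V) : exists A, supported u A.
Proof.
have /asboolP fu := valP u; exists (fset_set [set n | u n != 0]) => n.
by rewrite in_fset_set// notin_setE => /negP; rewrite negbK => /eqP.
Qed.

Lemma supportedU (V : lmodType K) (u : finfam V) (A B : {fset int}) :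
  supported u A \/ supported u B -> supported u (A `|` B)%fset.
Proof.
move=> h n; rewrite in_fsetU negb_or => /andP[nA nB].
by case: h => h; exact: h.
Qed.

Lemma supported_lin (V : lmodType K) (u v : finfam V) a A :
  supported u A -> supported v A -> supported (a *: u + v) A.
Proof.
move=> su sv n nA; rewrite -[LHS]/(a *: u n + v n).
by rewrite su// sv// scaler0 addr0.
Qed.

Lemma singleE (V : lmodType K) (x : V) (n k : int) :
  single x n k = if k == n then x else 0.
Proof. by []. Qed.

Lemma single_supported (V : lmodType K) (x : V) n :
  supported (single x n) [fset n]%fset.
Proof. by move=> k; rewrite in_fset1 singleE => /negbTE ->. Qed.

Lemma finfamP (V : lmodType K) (u v : finfam V) : u =1 v -> u = v.
Proof. by move=> uv; apply/val_inj/funext. Qed.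

Lemma finfam_sumE (V : lmodType K) (I : Type) (s : seq I)
    (u : I -> finfam V) n :
  (\sum_(i <- s) u i) n = \sum_(i <- s) u i n.
Proof.
by elim: s => [|i s ih]; rewrite ?big_nil// !big_cons -ih.
Qed.

Lemma single_linear (V : lmodType K) n : linear (fun x : V => single x n).
Proof.
move=> a x y; apply: finfamP => k.
rewrite -[RHS]/(a *: (single x n k) + single y n k) !singleE.
by case: ifP => // _; rewrite scaler0 addr0.
Qed.

Lemma single0 (V : lmodType K) n : single (0 : V) n = 0.
Proof. exact: linear_map0 (@single_linear V n). Qed.

Lemma finfam_singles (V : lmodType K) (u : finfam V) A :
  supported u A -> u = \sum_(n <- A) single (u n) n.
Proof.
move=> su; apply: finfamP => k; rewrite finfam_sumE.
have [kA|kA] := boolP (k \in A).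
  rewrite (bigD1_seq k) ?fset_uniq// singleE eqxx big1 ?Monoid.mulm1// => n nk.
  by rewrite singleE eq_sym (negbTE nk).
rewrite su// big_seq big1// => n nA; rewrite singleE.
by case: eqP => // kn; rewrite kn nA in kA.
Qed.

Lemma linear_ext (V W : lmodType K) (f h : finfam V -> W) :
  linear f -> linear h -> (forall x n, f (single x n) = h (single x n)) ->
  f =1 h.
Proof.
move=> lf lh fh u; have [A su] := supported_ex u.
rewrite (finfam_singles su) (linear_map_sum _ _ lf) (linear_map_sum _ _ lh).
by apply: eq_bigr => n _; exact: fh.
Qed.

Lemma bilinear_ext (V V' W : lmodType K) (f h : finfam V -> finfam V' -> W) :
  bilinear_map f -> bilinear_map h ->
  (forall x n y m, f (single x n) (single y m) = h (single x n) (single y m)) ->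
  forall u v, f u v = h u v.
Proof.
move=> [f1 f2] [h1 h2] fh u v; apply: (linear_ext (f1 v) (h1 v)) => x n.
by apply: (linear_ext (f2 _) (h2 _)) => y m.
Qed.

Lemma bilinear_ext1 (W : lmodType K) (f h : finfam K^o -> finfam K^o -> W) :
  bilinear_map f -> bilinear_map h ->
  (forall n m, f (single 1 n) (single 1 m) = h (single 1 n) (single 1 m)) ->
  forall u v, f u v = h u v.
Proof.
move=> bf bh fh; apply: bilinear_ext => // x n y m.
have sE (r : K) k : single (r : K^o) k = r *: single (1 : K^o) k.
  by rewrite -(linear_mapZ (@single_linear K^o k)) -[r *: _]/(r * 1) mulr1.
have [[f1 f2] [h1 h2]] := (bf, bh).
rewrite (sE x) (sE y) (linear_mapZ (f1 _)) (linear_mapZ (h1 _)).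
by rewrite (linear_mapZ (f2 _)) (linear_mapZ (h2 _)) fh.
Qed.

Lemma antisymmetric_ext (V W : lmodType K) (f : finfam V -> finfam V -> W) :
  bilinear_map f ->
  (forall x n y m,
     f (single x n) (single y m) = - f (single y m) (single x n)) ->
  forall u v, f u v = - f v u.
Proof.
move=> bf fA; apply: (bilinear_ext bf _ fA); have [f1 f2] := bf.
by split=> [v|u] a x y; rewrite ?f2 ?f1 opprD scalerN.
Qed.

(** Cyclic invariance brings each argument to the first place in turn, so
    linearity in the first argument suffices. *)
Lemma cyclic_trilinear0 (V W : lmodType K)
    (T : finfam V -> finfam V -> finfam V -> W) :
  (forall v w, linear (fun u => T u v w)) ->
  (forall u v w, T u v w = T v w u) ->
  (forall x n y m z k, T (single x n) (single y m) (single z k) = 0) ->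
  forall u v w, T u v w = 0.
Proof.
move=> lT cT T0 u v w.
have l0 : linear (fun _ : finfam V => 0 : W).
  by move=> ? ? ?; rewrite scaler0 addr0.
apply: (linear_ext (lT _ _) l0 _ u) => x n; rewrite cT.
apply: (linear_ext (lT _ _) l0 _ v) => y m; rewrite cT.
by apply: (linear_ext (lT _ _) l0 _ w) => z k; rewrite cT T0.
Qed.

Definition bilinear_coef (V W : lmodType K) (F : V -> int -> V -> int -> W) :=
  forall n m, bilinear_map (fun x y => F x n y m).

Section Bilext.
Variables (V W : lmodType K) (F : V -> int -> V -> int -> W).
Hypothesis lF : bilinear_coef F.

(** The terms outside the supports vanish by bilinearity, so the infinite sums
    may be taken over any finite sets that contain the supports. *)
Lemma bilextE (u v : finfam V) A B : supported u A -> supported v B ->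
  bilext F u v = \sum_(n <- A) \sum_(m <- B) F (u n) n (v m) m.
Proof.
move=> su sv; rewrite /bilext (@fsbigTE _ _ _ _ A); last first.
  move=> n nA; apply: fsbig1 => m _.
  by rewrite su// (linear_map0 ((lF n m).1 _)).
apply: eq_bigr => n _; rewrite (@fsbigTE _ _ _ _ B)// => m mB.
by rewrite sv// (linear_map0 ((lF n m).2 _)).
Qed.

Lemma bilext_bilinear : bilinear_map (bilext F).
Proof.
split=> [v|u] a w1 w2.
  have [A1 s1] := supported_ex w1; have [A2 s2] := supported_ex w2.
  have [B sB] := supported_ex v.
  have s1U : supported w1 (A1 `|` A2)%fset by apply: supportedU; left.
  have s2U : supported w2 (A1 `|` A2)%fset by apply: supportedU; right.
  rewrite (bilextE (supported_lin a s1U s2U) sB).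
  rewrite (bilextE s1U sB) (bilextE s2U sB).
  rewrite scaler_sumr -big_split; apply: eq_bigr => n _ /=.
  rewrite scaler_sumr -big_split; apply: eq_bigr => m _ /=.
  exact: (lF n m).1.
have [A1 s1] := supported_ex w1; have [A2 s2] := supported_ex w2.
have [B sB] := supported_ex u.
have s1U : supported w1 (A1 `|` A2)%fset by apply: supportedU; left.
have s2U : supported w2 (A1 `|` A2)%fset by apply: supportedU; right.
rewrite (bilextE sB (supported_lin a s1U s2U)).
rewrite (bilextE sB s1U) (bilextE sB s2U).
rewrite scaler_sumr -big_split; apply: eq_bigr => n _ /=.
rewrite scaler_sumr -big_split; apply: eq_bigr => m _ /=.
exact: (lF n m).2.
Qed.

Lemma bilext_single x n y m : bilext F (single x n) (single y m) = F x n y m.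
Proof.
rewrite (bilextE (@single_supported _ x n) (@single_supported _ y m)).
by rewrite !big_seq_fset1 !singleE !eqxx.
Qed.

End Bilext.
End FinitelySupported.

(** * Central extensions by two-cocycles *)

Section Extensions.
Variables (K : numFieldType) (L : lmodType K) (br : L -> L -> L).

Lemma eq_opp0 (W : lmodType K) (w : W) : w = - w -> w = 0.
Proof.
move=> /eqP; rewrite -addr_eq0 -mulr2n -scaler_nat scaler_eq0 pnatr_eq0 /=.
by move/eqP.
Qed.

Lemma lie_antisym : lie_algebra br -> forall x y, br x y = - br y x.
Proof.
move=> [[br1 br2] brxx _] x y; apply/eqP; rewrite -addr_eq0.
have := brxx (x + y).
rewrite (linear_mapD (br1 _)) !(linear_mapD (br2 _)) !brxx add0r addr0.
by move=> ->.
Qed.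

Lemma ext_bracket_lie (c : L -> L -> K^o) :
  lie_algebra br -> two_cocycle br c -> lie_algebra (ext_bracket br c).
Proof.
move=> brL [[c1 c2] cA cJ].
have [[br1 br2] brxx brJ] := brL.
split.
- split=> [v|u] a [t1 w1] [t2 w2]; rewrite /ext_bracket /=.
    by rewrite (c1 _ a) (br1 _ a).
  by rewrite (c2 _ a) (br2 _ a).
- by move=> [t x]; rewrite /ext_bracket /= brxx (eq_opp0 (cA x x)).
- move=> [t x] [s y] [r z]; rewrite /ext_bracket /=.
  congr (_, _); last exact: brJ.
  change (c x (br y z) + c y (br z x) + c z (br x y) = 0).
  rewrite (cA x) (cA y) (cA z) -!opprD; apply/eqP; rewrite oppr_eq0; apply/eqP.
  by rewrite -[RHS](cJ x y z) addrC addrA.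
Qed.

Lemma ext_bracket_central (c : L -> L -> K^o) :
  bilinear_map br -> bilinear_map c ->
  central (ext_bracket br c) (central_elt L).
Proof.
move=> [br1 br2] [c1 c2] [t x]; rewrite /ext_bracket /=.
by rewrite (linear_map0 (br1 _)) (linear_map0 (br2 _)) (linear_map0 (c1 _))
  (linear_map0 (c2 _)).
Qed.

End Extensions.

(** * The current algebra *)

Lemma addr_rot (V : zmodType) (x y z : V) : x + y + z = y + z + x.
Proof. by rewrite addrC addrA addrC addrA. Qed.

Section CurrentAlgebra.
Variables (R : realType) (g : vectType R[i]) (lb : g -> g -> g).
Local Notation C := R[i].

Section Bracket.
Variables (e1 e2 : C).
Local Notation a := (3%:R * e1).
Local Notation b := ((e1 - e2) * (2%:R * e1 + e2)).

(** x (x) (A_n A_m) for n + m = s, where t tells whether n and m are both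
    odd. *)
Definition single_mul (t : bool) (x : g) (s : int) : finfam g :=
  if t then single x s + single (a *: x) (s - 2) + single (b *: x) (s - 4)
  else single x s.

Lemma single_mul_linear t s : linear (fun x => single_mul t x s).
Proof.
move=> r x y; rewrite /single_mul.
case: t; last exact: single_linear.
have comm c w : c *: (r *: w) = r *: (c *: w) :> g by rewrite !scalerA mulrC.
rewrite !scalerDr (comm a) (comm b) !single_linear [RHS]addrACA.
by congr (_ + _); exact: addrACA.
Qed.

Hypothesis lbL : lie_algebra lb.

Lemma current_bracket_coef : bilinear_coef (fun x n y m =>
    if oddz n && oddz m then
      single (lb x y) (n + m)
      + single ((3%:R * e1) *: lb x y) (n + m - 2)
      + single (((e1 - e2) * (2%:R * e1 + e2)) *: lb x y) (n + m - 4)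
    else single (lb x y) (n + m)).
Proof.
have [[lb1 lb2] _ _] := lbL.
move=> n m; split=> z r x y.
  by rewrite lb1; exact: (single_mul_linear (oddz n && oddz m)).
by rewrite lb2; exact: (single_mul_linear (oddz n && oddz m)).
Qed.

Lemma current_bracket_bilinear : bilinear_map (current_bracket lb e1 e2).
Proof. exact: bilext_bilinear current_bracket_coef. Qed.

Lemma current_bracket_single x n y m :
  current_bracket lb e1 e2 (single x n) (single y m) =
  single_mul (oddz n && oddz m) (lb x y) (n + m).
Proof. exact: bilext_single current_bracket_coef _ _ _ _. Qed.

(** The lower terms of A_n A_m A_k appear once as soon as two of the indices
    are odd, and they do not appear twice when all three are: A_m A_k is then
    a combination of even A_j.  The condition is symmetric in n, m, k, so the
    Jacobi identity of the current algebra is that of g. *)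
Lemma current_bracket_triple x n y m z k :
  current_bracket lb e1 e2 (single x n)
    (current_bracket lb e1 e2 (single y m) (single z k)) =
  single_mul [|| oddz n && oddz m, oddz m && oddz k | oddz k && oddz n]
    (lb x (lb y z)) (n + m + k).
Proof.
have [[lb1 lb2] _ _] := lbL.
have [br1 br2] := current_bracket_bilinear.
have lZ r w : lb x (r *: w) = r *: lb x w by rewrite (linear_mapZ (lb2 _)).
rewrite current_bracket_single -addrA {1}/single_mul.
case: ifP => [/andP[om ok]|om].
  rewrite !(linear_mapD (br2 _)) !current_bracket_single !lZ !oddz_shift !oddzD
    om ok.
  rewrite /= !andbF orbT.
  by congr (single _ _ + single _ _ + single _ _); rewrite ?addrA.
rewrite current_bracket_single oddzD.
by case: (oddz n) (oddz m) (oddz k) om => [] [] [].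
Qed.

Lemma current_bracket_lie : lie_algebra (current_bracket lb e1 e2).
Proof.
have bbr := current_bracket_bilinear; have [br1 br2] := bbr.
have [_ _ lbJ] := lbL.
split=> // [u|u v w].
  apply: eq_opp0; apply: antisymmetric_ext => // x n y m.
  rewrite !current_bracket_single (lie_antisym lbL x) andbC (addrC m).
  by rewrite (linear_mapN (single_mul_linear _ _)).
apply: (cyclic_trilinear0 (T := fun u v w => _)) u v w.
- move=> v w r x y; rewrite (br1 (_ v w)) (br1 v) (br2 w _ x) (br2 v) (br2 w).
  by rewrite !scalerDr [RHS]addrACA; congr (_ + _); exact: addrACA.
- by move=> u v w; exact: addr_rot.
- move=> x n y m z k; rewrite !current_bracket_triple.
  rewrite -(addr_rot n m k) (addr_rot k n m).
  have maj_rot p q r :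
      [|| p && q, q && r | r && p] = [|| q && r, r && p | p && q].
    by case: p q r => [] [] [].
  rewrite -(maj_rot (oddz n)) (maj_rot (oddz k)); set t1 := [|| _, _ | _].
  have lt := single_mul_linear t1 (n + m + k).
  by have := linear_map0 lt; rewrite -(lbJ x y z) !(linear_mapD lt).
Qed.

End Bracket.
End CurrentAlgebra.

(** * The two-cocycle *)

Section Cocycle.
Variable R : realType.
Local Notation C := R[i].

Lemma kronE (n m k : int) : kron R m (- n + k) = (n + m == k)%:R.
Proof. by rewrite /kron; congr (nat_of_bool _)%:R; apply/eqP/eqP; lia. Qed.

Lemma pairing_sumE (e1 e2 : C) (n m : int) : pairing e1 e2 n m =
  if oddz n != oddz m then 0 else
  if oddz n then
    - n%:~R * (n + m == 0)%:R + 3%:R * e1 * (- n + 1)%:~R * (n + m == 2)%:R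
    + (e1 - e2) * (2%:R * e1 + e2) * (- n + 2)%:~R * (n + m == 4)%:R
  else - n%:~R * (n + m == 0)%:R.
Proof. by rewrite /pairing -[in X in kron _ _ X](addr0 (- n)) !kronE. Qed.

Lemma pairing_antisym (e1 e2 : C) n m : pairing e1 e2 n m = - pairing e1 e2 m n.
Proof.
rewrite !pairing_sumE (eq_sym (oddz m)); case: eqP => [<-|_];
  last by rewrite oppr0.
rewrite (addrC m).
have sub j : n + m = j -> m%:~R = j%:~R - n%:~R :> C.
  by move=> <-; rewrite rmorphD /= addrC addKr.
case: (n + m =P 0) => [s|_]; last case: (n + m =P 2) => [s|_];
  last case: (n + m =P 4) => [s|_].
- by rewrite ?s (sub _ s); case: ifP => _ /=; ring.
- by rewrite ?s !rmorphD !rmorphN /= (sub _ s); case: ifP => _ /=; ring.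
- by rewrite ?s !rmorphD !rmorphN /= (sub _ s); case: ifP => _ /=; ring.
- by case: ifP => _ /=; ring.
Qed.

(** The pairing of the product A_n A_m with A_k. *)
Definition pairing_mul (e1 e2 : C) (n m k : int) : C :=
  if oddz n && oddz m then
    pairing e1 e2 (n + m) k + 3%:R * e1 * pairing e1 e2 (n + m - 2) k
    + (e1 - e2) * (2%:R * e1 + e2) * pairing e1 e2 (n + m - 4) k
  else pairing e1 e2 (n + m) k.

(** The combinatorial form of \int d(A_n A_m A_k) = 0.  Only the values 0, 2, 4
    of n + m + k matter, and in each of them the coefficients add up to a
    multiple of n + m + k - j for the value j in question. *)
Lemma pairing_cyclic (e1 e2 : C) n m k :
  pairing_mul e1 e2 n m k + pairing_mul e1 e2 m k n + pairing_mul e1 e2 k n m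
  = 0.
Proof.
rewrite /pairing_mul !pairing_sumE !oddz_shift !oddzD.
set s := n + m + k.
have s2 : m + k + n = s by rewrite /s -addr_rot.
have s3 : k + n + m = s by rewrite /s addr_rot.
have sh (u v w j l : int) : u + v + w = s ->
  (u + v - j + w == l) = (s == l + j).
  by move=> <-; apply/eqP/eqP; lia.
have kE j : s = j -> k%:~R = j%:~R - n%:~R - m%:~R :> C.
  by move=> <-; rewrite /s !rmorphD /=; ring.
rewrite s2 s3 !(sh n m k)// !(sh m k n)// !(sh k n m)//.
rewrite !rmorphD !rmorphN /= !rmorphD /=.
case: (s =P 0) => [sE|_]; last case: (s =P 2) => [sE|_];
  last case: (s =P 4) => [sE|_].
- by rewrite ?sE (kE _ sE); case: (oddz n); case: (oddz m);
  case: (oddz k) => /=; ring.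
- by rewrite ?sE (kE _ sE); case: (oddz n); case: (oddz m);
  case: (oddz k) => /=; ring.
- by rewrite ?sE (kE _ sE); case: (oddz n); case: (oddz m);
  case: (oddz k) => /=; ring.
- by case: (oddz n); case: (oddz m); case: (oddz k) => /=; ring.
Qed.
End Cocycle.

Section Form.
Variables (R : realType) (g : vectType R[i]) (lb : g -> g -> g).
Variable (beta : g -> g -> R[i]^o).
Local Notation C := R[i].
Hypotheses (lbL : lie_algebra lb) (betaB : bilinear_map beta).
Hypotheses (betaS : lie_symmetric beta) (betaI : lie_invariant lb beta).

Lemma cocycle_coef p e1 e2 : bilinear_coef (fun x n y m =>
    eval2 p e1 e2 * beta x y * pairing e1 e2 n m : C^o).
Proof.
have [b1 b2] := betaB.
move=> n m; split=> z r x y; [rewrite b1|rewrite b2].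
  rewrite -[r *: beta x z]/(r * _) -[RHS]/(r * _ + _); ring.
rewrite -[r *: beta z x]/(r * _) -[RHS]/(r * _ + _); ring.
Qed.

Lemma cocycle_bilinear p e1 e2 : bilinear_map (cocycle beta p e1 e2).
Proof. exact: bilext_bilinear (@cocycle_coef p e1 e2). Qed.

Lemma cocycle_single p e1 e2 x n y m :
  cocycle beta p e1 e2 (single x n) (single y m) =
  eval2 p e1 e2 * beta x y * pairing e1 e2 n m.
Proof. exact: bilext_single (@cocycle_coef p e1 e2) _ _ _ _. Qed.

(** Symmetry and invariance make beta ([x, y], z) invariant under cyclic
    permutations, so that it factors out of the cyclic sum. *)
Lemma cocycle_two_cocycle p e1 e2 :
  two_cocycle (current_bracket lb e1 e2) (cocycle beta p e1 e2).
Proof.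
have cB := cocycle_bilinear p e1 e2; have [c1 c2] := cB.
have [br1 br2] := current_bracket_bilinear e1 e2 lbL.
have [b1 b2] := betaB.
have bZ r x y : beta (r *: x) y = r * beta x y by rewrite (linear_mapZ (b1 _)).
split=> // [|u v w].
  apply: antisymmetric_ext => // x n y m.
  by rewrite !cocycle_single pairing_antisym betaS; ring.
apply: (cyclic_trilinear0 (T := fun u v w => _)) u v w.
- move=> v w r x y; rewrite (br1 v) (c1 w) (c2 _ _ x) (br2 w) (c1 v).
  by rewrite !scalerDr [RHS]addrACA; congr (_ + _); exact: addrACA.
- by move=> u v w; exact: addr_rot.
- have mulE x n y m z k : cocycle beta p e1 e2
      (current_bracket lb e1 e2 (single x n) (single y m)) (single z k) =
      eval2 p e1 e2 * beta (lb x y) z * pairing_mul e1 e2 n m k.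
    rewrite current_bracket_single// /single_mul /pairing_mul.
    case: ifP => _; last exact: cocycle_single.
    by rewrite !(linear_mapD (c1 _)) !cocycle_single !bZ; ring.
  move=> x n y m z k; rewrite !mulE.
  have -> : beta (lb y z) x = beta (lb x y) z by rewrite betaS betaI.
  have -> : beta (lb z x) y = beta (lb x y) z by rewrite betaI betaS.
  have := pairing_cyclic e1 e2 n m k.
  move=> /(congr1 ( *%R (eval2 p e1 e2 * beta (lb x y) z))).
  by rewrite mulr0 !mulrDr.
Qed.

End Form.

(** * Almost-grading *)

Section Grading.
Variables (R : realType) (g : vectType R[i]) (lb : g -> g -> g).
Variable (beta : g -> g -> R[i]^o).
Local Notation C := R[i].
Local Notation B := (C^o * finfam g)%type.

Lemma degree_component_finsupp (d : int) (w : B) :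
  (fun n => (if n == d then w.1 else 0, single (w.2 n) n) : B) \in
  @Defs.finsupp _ B.
Proof.
have /asboolP fw := valP w.2.
rewrite unfold_in; apply/asboolP.
apply: (@sub_finite_set _ _ ([set d] `|` [set n | w.2 n != 0])); last first.
  by rewrite finite_setU; split; [exact: finite_set1|exact: fw].
move=> n /=; have [->|nd] := eqVneq n d; first by left.
have [->|] := eqVneq (w.2 n) 0; last by right.
by rewrite single0 eqxx.
Qed.

Definition degree_component (d : int) (w : B) : finfam B :=
  FinFam (degree_component_finsupp d w).

Lemma degree_componentE d w n :
  degree_component d w n = (if n == d then w.1 else 0, single (w.2 n) n).
Proof. by []. Qed.

Lemma degree_component_in d w n : ext_degree d n (degree_component d w n).
Proof. by split=> [/negbTE /= ->|] //; exists (w.2 n). Qed.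

Lemma fst_sum (I : Type) (s : seq I) (F : I -> B) :
  (\sum_(i <- s) F i).1 = \sum_(i <- s) (F i).1.
Proof. by elim: s => [|i s ih]; rewrite ?big_nil// !big_cons -ih. Qed.

Lemma snd_sum (I : Type) (s : seq I) (F : I -> B) :
  (\sum_(i <- s) F i).2 = \sum_(i <- s) (F i).2.
Proof. by elim: s => [|i s ih]; rewrite ?big_nil// !big_cons -ih. Qed.

Lemma fsum_supported (V : lmodType C) (c : finfam V) (A : {fset int}) :
  supported c A -> \sum_(n \in [set: int]) c n = \sum_(n <- A) c n.
Proof. by move=> sc; rewrite (@fsbigTE _ _ _ _ A). Qed.

Lemma degree_component_sum d w :
  w = \sum_(n \in [set: int]) degree_component d w n.
Proof.
have [A sA] := supported_ex w.2.
have [D sD] := supported_ex (degree_component d w).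
have sAU : supported w.2 (A `|` D `|` [fset d])%fset.
  by apply: supportedU; left; apply: supportedU; left.
rewrite (fsum_supported (A := (A `|` D `|` [fset d])%fset)); last first.
  by apply: supportedU; left; apply: supportedU; right.
rewrite [LHS]surjective_pairing [RHS]surjective_pairing fst_sum snd_sum /=.
congr (_, _); last exact: finfam_singles.
rewrite (bigD1_seq d) ?fset_uniq ?in_fsetE ?eqxx ?orbT//=.
by rewrite big1 ?addr0// => n /negbTE ->.
Qed.

(** An element of degree n is seen in the n-th coordinate of the second
    component only, and in the first component only if n = d. *)
Lemma degree_component_unique d (c : finfam B) :
  (forall n, ext_degree d n (c n)) ->
  c = degree_component d (\sum_(n \in [set: int]) c n).
Proof.
move=> cd; apply: finfamP => k.
have [A sA] := supported_ex c.
have sAU : supported c (A `|` [fset d; k])%fset by apply: supportedU; left.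
rewrite (fsum_supported sAU) /= fst_sum snd_sum finfam_sumE.
have other n : n != k -> (c n).2 k = 0.
  by have [_ [x ->]] := cd n; rewrite singleE eq_sym => /negbTE ->.
rewrite [LHS]surjective_pairing; congr (_, _).
  have [->|kd] := eqVneq k d; last exact: (cd k).1.
  rewrite (bigD1_seq d) ?fset_uniq ?in_fsetE ?eqxx ?orbT//=.
  by rewrite big1 ?addr0// => n nd; exact: (cd n).1.
rewrite (bigD1_seq k) ?fset_uniq ?in_fsetE ?eqxx ?orbT//=.
rewrite big1 ?addr0//.
by have [_ [x ->]] := cd k; rewrite singleE eqxx.
Qed.

Lemma ext_degree_decomposition d : direct_decomposition (@ext_degree R g d).
Proof.
split=> [n|w].
  split=> [|r u v [u1 [x u2]] [v1 [y v2]]].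
    by split=> //; exists 0; rewrite single0.
  split=> [nd|]; first by rewrite /= u1// v1// scaler0 addr0.
  by exists (r *: x + y); rewrite /= u2 v2 (@single_linear _ _ n).
exists (degree_component d w); split.
  by split; [exact: degree_component_in|exact: degree_component_sum].
by move=> c [cd ->]; exact/esym/degree_component_unique.
Qed.

Lemma ext_degree_finite_dim d n : finite_dim (@ext_degree R g d n).
Proof.
pose X := vbasis {: g}; pose N := \dim {: g}.
exists ((1, 0) :: mkseq (fun i => (0, single X`_i n)) N).
move=> [t w] [_ [x /= ->]].
pose a i := if i is j.+1 then oapp (fun o => coord X o x) 0 (insub j) else t.
exists (fun i => a (nat_of_ord i)).
rewrite -(big_mkord xpredT (fun i => a i *: ((1, 0) :: mkseq _ N)`_i)) /=.
rewrite size_mkseq big_nat_recl// big_mkord /=.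
rewrite [RHS]surjective_pairing /= fst_sum snd_sum; congr (_, _).
  rewrite [X in _ + X]big1 ?addr0 -?[t%:A]/(t * 1) ?mulr1// => i _.
  by rewrite nth_mkseq//= scaler0.
rewrite scaler0 add0r {1}(coord_vbasis (memvf x)).
rewrite (linear_map_sum _ _ (@single_linear _ _ n)); apply: eq_bigr => i _.
by rewrite nth_mkseq//= (linear_mapZ (@single_linear _ _ n)) valK.
Qed.

Hypotheses (lbL : lie_algebra lb) (betaB : bilinear_map beta).

(** The central component of a bracket sits in degree d, whatever n + m is;
    it stays within bounded distance of n + m because the cocycle vanishes
    unless n + m is 0, 2 or 4. *)
Lemma family_almost_graded p e1 e2 d :
  almost_graded (family_bracket lb beta p e1 e2) (@ext_degree R g d).
Proof.
split; [exact: ext_degree_decomposition|exact: ext_degree_finite_dim|].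
(* If the cocycle is nonzero, d - (n + m) is one of d, d - 2, d - 4. *)
exists (Num.min (- 4) (d - 4)), (Num.max 0 d) => n m u v [_ [x u2]] [_ [y v2]].
set w := family_bracket _ _ _ _ _ _ _.
exists (degree_component d w); split; last exact: degree_component_sum.
  exact: degree_component_in.
move=> h wh.
have w1 : w.1 = eval2 p e1 e2 * beta x y * pairing e1 e2 n m.
  by rewrite /w /= u2 v2 cocycle_single.
have w2 : w.2 = single_mul e1 e2 (oddz n && oddz m) (lb x y) (n + m).
  by rewrite /w /= u2 v2 current_bracket_single.
have [w2h|w2h] := eqVneq (w.2 h) 0.
  have [hd|hd] := eqVneq h d; last first.
    by move: wh; rewrite degree_componentE (negbTE hd) w2h single0 eqxx.
  have : [|| n + m == 0, n + m == 2 | n + m == 4].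
    apply: contra_neqT wh => /norP[/negbTE s0 /norP[/negbTE s2 /negbTE s4]].
    rewrite degree_componentE w2h single0 w1 pairing_sumE s0 s2 s4.
    by rewrite !mulr0 !addr0 !if_same mulr0 if_same.
  by move: hd; clear; lia.
have : [|| h == n + m, h == n + m - 2 | h == n + m - 4].
  apply: contra_neqT w2h => /norP[/negbTE s0 /norP[/negbTE s2 /negbTE s4]].
  rewrite w2 /single_mul; case: ifP => _; last by rewrite singleE s0.
  rewrite -[LHS]/(single _ _ h + single _ _ h + single _ _ h).
  by rewrite !singleE s0 s2 s4 !addr0.
by clear; lia.
Qed.

End Grading.

(** * The special element *)

Section SpecialElement.
Variables (R : realType) (g : vectType R[i]) (lb : g -> g -> g).
Variable (beta : g -> g -> R[i]^o).
Local Notation C := R[i].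
Hypotheses (lbL : lie_algebra lb) (betaB : bilinear_map beta).

Lemma classical_current_coef :
  bilinear_coef (fun x n y m => single (lb x y) (n + m)).
Proof.
have [[lb1 lb2] _ _] := lbL.
by move=> n m; split=> z r x y; rewrite ?lb1 ?lb2; exact: single_linear.
Qed.

Lemma current_bracket00 u v :
  current_bracket lb 0 0 u v = classical_current_bracket lb u v.
Proof.
apply: bilinear_ext u v.
- exact: current_bracket_bilinear.
- exact: bilext_bilinear classical_current_coef.
- move=> x n y m; rewrite current_bracket_single// /classical_current_bracket.
  rewrite (bilext_single classical_current_coef) /single_mul.
  by rewrite subrr mul0r mulr0 !scale0r !single0 !addr0 if_same.
Qed.

Lemma pairing00 n m : pairing (0 : C) 0 n m = - n%:~R * kron R m (- n).
Proof.
rewrite /pairing subrr mulr0 !mul0r !addr0 if_same.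
case: eqP => //= nm; rewrite /kron; case: eqP => [mn|_]; last by rewrite mulr0.
by case: nm; rewrite mn /oddz abszN.
Qed.

Lemma classical_cocycle_coef : bilinear_coef (fun x n y m =>
  - (beta x y * n%:~R * kron R m (- n)) : C^o).
Proof.
have [b1 b2] := betaB.
move=> n m; split=> z r x y; [rewrite b1|rewrite b2].
  rewrite -[r *: beta x z]/(r * _) -[RHS]/(r * _ + _); ring.
rewrite -[r *: beta z x]/(r * _) -[RHS]/(r * _ + _); ring.
Qed.

Lemma cocycle00 p u v : cocycle beta p 0 0 u v = eval2 p 0 0 *
  bilext (fun x n y m => - (beta x y * n%:~R * kron R m (- n)) : C^o) u v.
Proof.
have cB := bilext_bilinear classical_cocycle_coef.
pose h u v : C^o := eval2 p 0 0 *
  bilext (fun x n y m => - (beta x y * n%:~R * kron R m (- n)) : C^o) u v.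
apply: (bilinear_ext (h := h)) u v; rewrite /h.
- exact: cocycle_bilinear.
- have [c1 c2] := cB; split=> w r x y; rewrite (c1, c2).
    rewrite -[r *: bilext _ _ _]/(r * _) -[RHS]/(r * _ + _); ring.
  rewrite -[r *: bilext _ _ _]/(r * _) -[RHS]/(r * _ + _); ring.
- move=> x n y m; rewrite cocycle_single//.
  by rewrite (bilext_single classical_cocycle_coef) pairing00; ring.
Qed.

(** Rescaling the central element absorbs the factor p(0, 0). *)
Lemma family_special_isom p : eval2 p 0 0 != 0 ->
  exists phi : C^o * finfam g -> C^o * finfam g,
    lie_isomorphism (family_bracket lb beta p 0 0)
      (classical_affine_bracket lb beta) phi /\ forall w, (phi w).2 = w.2.
Proof.
move=> pN0; exists (fun w => ((eval2 p 0 0)^-1 * w.1, w.2)); split => //; split.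
- move=> r [t u] [s v] /=; congr (_, _).
  by rewrite mulrDr -[r *: t]/(r * t) mulrCA.
- exists (fun w => (eval2 p 0 0 * w.1, w.2)) => -[t u] /=.
    by rewrite mulVKf.
  by rewrite mulKf.
- move=> [t u] [s v].
  rewrite /family_bracket /classical_affine_bracket /ext_bracket /=.
  by rewrite cocycle00 mulKf// current_bracket00.
Qed.

End SpecialElement.

(** * Differentiation and integration of complex-valued paths *)

Section PathCalculus.
Variable R : realType.
Local Notation C := R[i].
Implicit Types (f h : R -> C) (t : R).

Definition ccont_at h t : Prop :=
  {for t, continuous (fun s => complex.Re (h s) : R)} /\
  {for t, continuous (fun s => complex.Im (h s) : R)}.

Lemma path_continuousP h : path_continuous h <-> forall t, ccont_at h t.
Proof.
split=> [[h1 h2] s|hc]; first by split; [exact: h1|exact: h2].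
by split=> s; have [] := hc s.
Qed.

Lemma ccont_at_cst (c : C) t : ccont_at (fun=> c) t.
Proof. by split; exact: cst_continuous. Qed.

Lemma ccont_at_real t0 t : ccont_at (fun s => (s - t0)%:C) t.
Proof.
split; last exact: cst_continuous.
by apply: cvgB; [exact: cvg_id|exact: cvg_cst].
Qed.

Lemma ccont_atD f h t : ccont_at f t -> ccont_at h t ->
  ccont_at (fun s => f s + h s) t.
Proof.
move=> [f1 f2] [h1 h2]; split; rewrite /prop_for.
  rewrite (_ : (fun s => _) = fun s =>
      complex.Re (f s) + complex.Re (h s)); last first.
    by apply/funext => s; case: (f s) (h s) => ? ? [? ?].
  by apply: cvgD; [exact: f1|exact: h1].
rewrite (_ : (fun s => _) = fun s =>
    complex.Im (f s) + complex.Im (h s)); last first.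
  by apply/funext => s; case: (f s) (h s) => ? ? [? ?].
by apply: cvgD; [exact: f2|exact: h2].
Qed.

Lemma ccont_atM f h t : ccont_at f t -> ccont_at h t ->
  ccont_at (fun s => f s * h s) t.
Proof.
move=> [f1 f2] [h1 h2]; split; rewrite /prop_for.
  rewrite (_ : (fun s => _) = fun s => complex.Re (f s) * complex.Re (h s)
     - complex.Im (f s) * complex.Im (h s)); last first.
    by apply/funext => s; case: (f s) (h s) => ? ? [? ?].
  by apply: cvgB; apply: cvgM; [exact: f1|exact: h1|exact: f2|exact: h2].
rewrite (_ : (fun s => _) = fun s => complex.Re (f s) * complex.Im (h s)
   + complex.Im (f s) * complex.Re (h s)); last first.
  by apply/funext => s; case: (f s) (h s) => ? ? [? ?].
by apply: cvgD; apply: cvgM; [exact: f1|exact: h2|exact: f2|exact: h1].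
Qed.

Lemma ccont_atV f t : f t != 0 -> ccont_at f t ->
  ccont_at (fun s => (f s)^-1) t.
Proof.
move=> f0 [f1 f2].
pose N s := complex.Re (f s) ^+ 2 + complex.Im (f s) ^+ 2.
have N0 : N t != 0.
  apply: contra f0; rewrite /N paddr_eq0 ?sqr_ge0// !sqrf_eq0 => /andP[r0 i0].
  by rewrite eq_complex r0 i0.
have cN : {for t, continuous N}.
  by apply: cvgD; apply: cvgM; [exact: f1|exact: f1|exact: f2|exact: f2].
split; rewrite /prop_for.
  rewrite (_ : (fun s => _) = fun s => complex.Re (f s) / N s); last first.
    by apply/funext => s; rewrite /N; case: (f s).
  by apply: cvgM; [exact: f1|apply: cvgV].
rewrite (_ : (fun s => _) = fun s => - (complex.Im (f s) / N s)); last first.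
  by apply/funext => s; rewrite /N; case: (f s).
by apply: cvgN; apply: cvgM; [exact: f2|apply: cvgV].
Qed.

Lemma ccont_at_near f h t :
  (\forall s \near t, f s = h s) -> ccont_at f t -> ccont_at h t.
Proof.
move=> fh [f1 f2]; have fht := nbhs_singleton fh.
split; rewrite /prop_for /continuous_at -fht.
  by apply: cvg_trans f1; apply: near_eq_cvg; apply: filterS fh => s ->.
by apply: cvg_trans f2; apply: near_eq_cvg; apply: filterS fh => s ->.
Qed.

Lemma ccont_at_neq0 f t : ccont_at f t -> f t != 0 ->
  \forall s \near t, f s != 0.
Proof.
move=> [f1 f2]; rewrite eq_complex negb_and => /orP[] ft.
  by apply: filterS (cvgr_neq0 _ f1 ft) => s /=; apply: contraNneq => ->.
by apply: filterS (cvgr_neq0 _ f2 ft) => s /=; apply: contraNneq => ->.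
Qed.

Lemma path_continuous_inv f : (forall t, f t != 0) -> path_continuous f ->
  path_continuous (fun t => (f t)^-1).
Proof.
move=> f0 /path_continuousP fc; apply/path_continuousP => t.
exact: ccont_atV.
Qed.

(** Caratheodory's form of the derivative: the product and square root rules
    become identities between slopes phi, and continuity of phi is all the
    analysis they need. *)
Definition has_cder h t (d : C) : Prop :=
  exists phi : R -> C,
    [/\ forall s, h s - h t = (s - t)%:C * phi s, ccont_at phi t & phi t = d].

Lemma has_cder_is_derive h t d : has_cder h t d ->
  [/\ is_derive t 1 (fun s => complex.Re (h s) : R) (complex.Re d : R),
      is_derive t 1 (fun s => complex.Im (h s) : R) (complex.Im d : R) &
      cder h t = d].
Proof.
move=> [phi [hphi [p1 p2] <-]].
have dr :
    is_derive t 1 (fun s => complex.Re (h s) : R) (complex.Re (phi t) : R).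
  apply/is_derive1_caratheodory; exists (fun s => complex.Re (phi s)).
  split=> // s; have := congr1 (@complex.Re R) (hphi s).
  by case: (h s) (h t) (phi s) => ? ? [? ?] [? ?] /= ->; ring.
have di :
    is_derive t 1 (fun s => complex.Im (h s) : R) (complex.Im (phi t) : R).
  apply/is_derive1_caratheodory; exists (fun s => complex.Im (phi s)).
  split=> // s; have := congr1 (@complex.Im R) (hphi s).
  by case: (h s) (h t) (phi s) => ? ? [? ?] [? ?] /= ->; ring.
split=> //; rewrite /cder !derive1E !derive_val.
by case: (phi t).
Qed.

Lemma has_cder_ccont_at h t d : has_cder h t d -> ccont_at h t.
Proof.
move=> [phi [hphi pc _]].
rewrite (_ : h = fun s => h t + (s - t)%:C * phi s); last first.
  by apply/funext => s; rewrite -hphi addrC subrK.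
apply: ccont_atD; first exact: ccont_at_cst.
by apply: ccont_atM => //; exact: ccont_at_real.
Qed.

Lemma has_cderD f h t d e : has_cder f t d -> has_cder h t e ->
  has_cder (fun s => f s + h s) t (d + e).
Proof.
move=> [p [fp pc <-]] [q [hq qc <-]]; exists (fun s => p s + q s); split=> //.
  by move=> s; rewrite mulrDr -fp -hq opprD addrACA.
exact: ccont_atD.
Qed.

Lemma has_cderZ (c : C) h t d : has_cder h t d ->
  has_cder (fun s => c * h s) t (c * d).
Proof.
move=> [q [hq qc <-]]; exists (fun s => c * q s); split=> //.
  by move=> s; rewrite -mulrBr hq mulrCA.
by apply: ccont_atM => //; exact: ccont_at_cst.
Qed.

Lemma has_cderM f h t d e : has_cder f t d -> has_cder h t e ->
  has_cder (fun s => f s * h s) t (d * h t + f t * e).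
Proof.
move=> fd hd; have fc := has_cder_ccont_at fd.
move: fd hd => [p [fp pc <-]] [q [hq qc <-]].
exists (fun s => p s * h t + f s * q s); split=> //.
  move=> s; rewrite mulrDr mulrA -fp mulrCA -hq; ring.
apply: ccont_atD; apply: ccont_atM => //.
exact: ccont_at_cst.
Qed.

(** Y s - Y t is (P s - P t) / (Y s + Y t), so the slope of Y is the slope of
    P divided by Y s + Y t.  Continuity of Y excludes a jump between the two
    square roots and keeps the denominator away from 0 near t. *)
Lemma has_cder_sqrt (Y P : R -> C) t d : path_continuous Y ->
  (forall s, Y s ^+ 2 = P s) -> Y t != 0 -> has_cder P t d ->
  has_cder Y t (d / (2%:R * Y t)).
Proof.
move=> Yc YP Yt [phi [Pphi pc <-]].
(* The first branch only makes the slope identity hold far from t. *)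
pose psi s := if Y s + Y t == 0 then (s - t)%:C^-1 * (Y s - Y t)
  else phi s / (Y s + Y t).
have twoYt : Y t + Y t != 0 by rewrite -mulr2n mulrn_eq0.
exists psi; split.
- move=> s; rewrite /psi; case: eqP => [sY|/eqP sY].
    have [->|st] := eqVneq s t; first by rewrite !subrr mul0r.
    rewrite mulVKf//; apply: contra st.
    by rewrite eq_complex /= eqxx andbT subr_eq0.
  rewrite mulrA -Pphi -!YP; field.
  exact: sY.
- have cs : ccont_at (fun s => Y s + Y t) t.
    apply: ccont_atD; last exact: ccont_at_cst.
    by move/path_continuousP: Yc; exact.
  have cq : ccont_at (fun s => phi s / (Y s + Y t)) t.
    by apply: ccont_atM => //; exact: ccont_atV.
  apply: ccont_at_near cq; apply: filterS (ccont_at_neq0 cs twoYt) => s.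
  by rewrite /psi => /negbTE ->.
- by rewrite /psi (negbTE twoYt) -mulr2n mulr_natl.
Qed.

Lemma has_cder_cis (a t : R) :
  has_cder (fun s => cis (a * s)) t ((0 +i* a) * cis (a * t)).
Proof.
have dl : is_derive t 1 (fun s : R => a * s) a.
  apply/is_derive1_caratheodory; exists (fun=> a); split=> // [s|].
    by rewrite mulrBr.
  exact: cst_continuous.
have := @is_derive1_comp _ (@cos R) (fun s => a * s) t _ _ (is_derive_cos _) dl.
have := @is_derive1_comp _ (@sin R) (fun s => a * s) t _ _ (is_derive_sin _) dl.
move=> /is_derive1_caratheodory[p [ps pc pt]].
move=> /is_derive1_caratheodory[q [qs qc qt]].
exists (fun s => q s +i* p s); split.
- move=> s; rewrite /cis; apply/eqP; rewrite eq_complex /= qs ps.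
  by apply/andP; split; apply/eqP; ring.
- by split.
- rewrite pt qt; apply/eqP; rewrite eq_complex /=.
  by apply/andP; split; apply/eqP; ring.
Qed.

Lemma Rintegral_FTC (f F : R -> R) (a b : R) : a < b -> continuous f ->
  (forall t, a <= t <= b -> is_derive t 1 F (f t)) ->
  \int[lebesgue_measure]_(t in `[a, b]) f t = F b - F a.
Proof.
move=> ab cf dF.
have cF t : a <= t <= b -> {for t, continuous F}.
  move=> /dF[dr _]; apply: differentiable_continuous.
  exact/derivable1_diffP.
rewrite /Rintegral (@continuous_FTC2 _ f F) //.
- exact: continuous_subspaceT.
- split.
  + by move=> t; rewrite in_itv /= => /andP[? ?]; have [] := dF t; rewrite ?ltW.
  + by apply: cvg_at_right_filter; apply: cF; rewrite lexx ltW.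
  + by apply: cvg_at_left_filter; apply: cF; rewrite lexx ltW.
- move=> t; rewrite in_itv /= => /andP[? ?].
  have d : is_derive t 1 F (f t) by apply: dF; rewrite !ltW.
  by rewrite derive1E derive_val.
Qed.

Lemma cint_FTC (h H : R -> C) a b : a < b -> path_continuous h ->
  (forall t, has_cder H t (h t)) -> cint a b h = H b - H a.
Proof.
move=> ab [h1 h2] dH; rewrite /cint.
have dr t : a <= t <= b ->
    is_derive t 1 (fun s => complex.Re (H s) : R) (complex.Re (h t) : R).
  by move=> _; have [] := has_cder_is_derive (dH t).
have di t : a <= t <= b ->
    is_derive t 1 (fun s => complex.Im (H s) : R) (complex.Im (h t) : R).
  by move=> _; have [] := has_cder_is_derive (dH t).
rewrite (Rintegral_FTC ab h1 dr) (Rintegral_FTC ab h2 di).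
by case: (H b) (H a) => ? ? [? ?].
Qed.

Lemma continuous_integrable (f : R -> R) a b : continuous f ->
  lebesgue_measure.-integrable `[a, b] (EFin \o f).
Proof.
move=> cf; apply: continuous_compact_integrable; first exact: segment_compact.
exact: continuous_subspaceT.
Qed.

Lemma Rintegral_linear (r : R) (f h : R -> R) a b :
  continuous f -> continuous h ->
  \int[lebesgue_measure]_(t in `[a, b]) (r * f t + h t) =
  r * \int[lebesgue_measure]_(t in `[a, b]) f t
  + \int[lebesgue_measure]_(t in `[a, b]) h t.
Proof.
move=> cf ch.
rewrite RintegralD//; last exact: continuous_integrable.
  by rewrite RintegralZl//; exact: continuous_integrable.
apply: (@continuous_integrable (fun t => r * f t)) => t.
by apply: cvgM; [exact: cvg_cst|exact: cf].
Qed.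

Lemma continuous_linear (r : R) (f h : R -> R) :
  continuous f -> continuous h -> continuous (fun t => r * f t + h t).
Proof.
move=> cf ch t; apply: cvgD; last exact: ch.
by apply: cvgM; [exact: cvg_cst|exact: cf].
Qed.

Lemma cint_linear (c : C) f h a b : path_continuous f -> path_continuous h ->
  cint a b (fun t => c * f t + h t) = c * cint a b f + cint a b h.
Proof.
move=> [f1 f2] [h1 h2]; rewrite /cint.
case: c => x y.
rewrite (_ : (fun t => complex.Re _) = fun t => x * complex.Re (f t) +
    (- y * complex.Im (f t) + complex.Re (h t))); last first.
  by apply/funext => t; case: (f t) (h t) => ? ? [? ?] /=; ring.
rewrite (_ : (fun t => complex.Im _) = fun t => x * complex.Im (f t) +
    (y * complex.Re (f t) + complex.Im (h t))); last first.
  by apply/funext => t; case: (f t) (h t) => ? ? [? ?] /=; ring.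
rewrite (Rintegral_linear x a b f1 (@continuous_linear (- y) _ _ f2 h1)).
rewrite (Rintegral_linear (- y) a b f2 h1).
rewrite (Rintegral_linear x a b f2 (@continuous_linear y _ _ f1 h2)).
rewrite (Rintegral_linear y a b f1 h2).
by apply/eqP; rewrite eq_complex /=; apply/andP; split; apply/eqP; ring.
Qed.

(** If G is a primitive of f, so is t |-> - G (t + p).  Comparing the two
    values of the integral over [0, p] gives G (2 p) = G 0. *)
Lemma Rintegral_antiperiodic (f : R -> R) (p : R) : 0 < p -> continuous f ->
  (forall t, f (t + p) = - f t) ->
  \int[lebesgue_measure]_(t in `[0, 2%:R * p]) f t = 0.
Proof.
move=> p0 cf fp.
(* Starting at -1 makes G differentiable at the endpoint 0 as well. *)
pose G (x : R) := \int[lebesgue_measure]_(t in `[-1, x]) f t.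
have dG (x : R) : -1 < x -> is_derive x 1 G (f x).
  move=> x1; have xx : x < x + 1 by rewrite ltrDl.
  have [dr dv] := @continuous_FTC1_closed R f (-1) x (x + 1) xx
    (continuous_integrable _ _ cf) x1 (cf x).
  apply: (DeriveDef dr); rewrite -derive1E; exact: dv.
have dGp (x : R) : -1 < x + p -> is_derive x 1 (fun t => - G (t + p)) (f x).
  move=> /dG dGx.
  have ds : is_derive x 1 (fun t : R => t + p) 1.
    apply/is_derive1_caratheodory; exists (fun=> 1); split=> // [s|].
      by rewrite mul1r opprD addrACA subrr addr0.
    exact: cst_continuous.
  have := is_deriveN (@is_derive1_comp _ G (fun t : R => t + p) x _ _ dGx ds).
  by rewrite mulr1 fp opprK.
have p2 : 0 < 2%:R * p by rewrite mulr_gt0.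
have I1 : \int[lebesgue_measure]_(t in `[0, p]) f t = G p - G 0.
  apply: Rintegral_FTC => // t /andP[t0 _].
  by apply: dG; rewrite (lt_le_trans _ t0)// ltrN10.
have : \int[lebesgue_measure]_(t in `[0, p]) f t = - G (p + p) - - G (0 + p).
  apply: (Rintegral_FTC (F := fun t => - G (t + p))) => // t /andP[t0 _].
  by apply: dGp; rewrite (lt_le_trans (ltrN10 _))// addr_ge0// ltW.
rewrite I1.
have -> : \int[lebesgue_measure]_(t in `[0, 2%:R * p]) f t = G (2%:R * p) - G 0.
  apply: Rintegral_FTC => // t /andP[t0 _].
  by apply: dG; rewrite (lt_le_trans _ t0)// ltrN10.
by rewrite add0r (_ : 2%:R * p = p + p); [lra|ring].
Qed.

Lemma cint_antiperiodic h (p : R) : 0 < p -> path_continuous h ->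
  (forall t, h (t + p) = - h t) -> cint 0 (2%:R * p) h = 0.
Proof.
move=> p0 [h1 h2] hp; rewrite /cint !(Rintegral_antiperiodic p0)//.
  by move=> t; rewrite hp; case: (h t).
by move=> t; rewrite hp; case: (h t).
Qed.

End PathCalculus.

(** * The lift of the circle to the curve *)

Section Cycle.
Variable R : realType.
Local Notation C := R[i].

Lemma cisD (s t : R) : cis (s + t) = cis s * cis t.
Proof.
rewrite /cis cosD sinD; apply/eqP; rewrite eq_complex /=.
by rewrite eqxx /= addrC.
Qed.

Lemma cis_neq0 (t : R) : cis t != 0.
Proof. by rewrite -normr_eq0 normc_cis oner_eq0. Qed.

Lemma cisDpi (t : R) : cis (t + pi) = - cis t.
Proof. by apply/eqP; rewrite /cis eq_complex /= cosDpi sinDpi !eqxx. Qed.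

Lemma cisN (t : R) : cis (- t) = (cis t)^-1.
Proof.
apply: (mulfI (cis_neq0 t)); rewrite divff ?cis_neq0// -cisD subrr.
by rewrite /cis cos0 sin0.
Qed.

Lemma cis_int (k : int) (t : R) : cis (k%:~R * t) = cis t ^ k.
Proof.
have nat_case (n : nat) : cis (n%:R * t) = cis t ^+ n.
  elim: n => [|n ih]; first by rewrite mul0r /cis cos0 sin0.
  by rewrite -natr1 mulrDl mul1r cisD ih exprSr.
case: k => n; first exact: nat_case.
by rewrite NegzE rmorphN mulNr cisN [in LHS]nat_case -exprnN.
Qed.

Lemma nonvanishing_sign (f : R -> R) (s t : R) : continuous f ->
  (forall u, f u != 0) -> 0 < f s -> 0 < f t.
Proof.
move=> cf f0 fs; rewrite ltNge; apply/negP => ft.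
have cw a b : {within `[a, b], continuous f} by exact: continuous_subspaceT.
have [st|ts] := leP s t.
  have [|c _ /eqP] := @IVT R f s t 0 st (cw _ _).
    by rewrite ge_min le_max (ltW fs) ft orbT.
  by rewrite (negbTE (f0 c)).
have [|c _ /eqP] := @IVT R f t s 0 (ltW ts) (cw _ _).
  by rewrite ge_min le_max (ltW fs) ft orbT.
by rewrite (negbTE (f0 c)).
Qed.

(** The values of q are 1 and -1, hence its real part has no zero and keeps its
    sign. *)
Lemma sqr_eq1_cst (q : R -> C) s t : path_continuous q ->
  (forall u, q u ^+ 2 = 1) -> q s = q t.
Proof.
move=> [q1 _] q2.
have qpm u : q u = 1 \/ q u = -1.
  by have /eqP := q2 u; rewrite sqrf_eq1 => /orP[]/eqP; [left|right].
have r0 u : complex.Re (q u) != 0.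
  by case: (qpm u) => ->; rewrite /= ?oner_eq0// oppr_eq0 oner_eq0.
have N0 : ~ (0 < -1 :> R) by rewrite ltNge lerN10.
have [qs|qs] := qpm s; have [qt|qt] := qpm t; rewrite ?qs ?qt//.
  have := @nonvanishing_sign _ s t q1 r0; rewrite qs qt /=.
  by move=> /(_ ltr01) /N0.
have := @nonvanishing_sign _ t s q1 r0; rewrite qs qt /=.
by move=> /(_ ltr01) /N0.
Qed.

(** Two continuous square roots of the same nonvanishing function differ by a
    constant sign. *)
Lemma sqr_eq_antiperiodic (Y W : R -> C) (p : R) :
  path_continuous Y -> path_continuous W -> (forall t, W t != 0) ->
  (forall t, Y t ^+ 2 = W t ^+ 2) -> (forall t, W (t + p) = - W t) ->
  forall t, Y (t + p) = - Y t.
Proof.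
move=> Yc Wc W0 YW Wp t.
have qc : path_continuous (fun u => Y u * (W u)^-1).
  by apply: path_continuous_mul => //; exact: path_continuous_inv.
have q2 u : (Y u * (W u)^-1) ^+ 2 = 1.
  by rewrite exprMn YW exprVn divff// expf_neq0.
have /= := sqr_eq1_cst (t + p) t qc q2.
rewrite Wp invrN mulrN => /(congr1 (fun v => - (v * W t))).
by rewrite mulNr opprK !mulfVK// => ->.
Qed.

(** The function 1 + w u stays in the right half-plane, where a square root has
    a nonzero real part.  So the real part of a continuous square root keeps
    its sign, which selects the same root at t and at t + p. *)
Lemma unit_circle_sqrt (w : C) (u : R -> C) (p : R) : `|w| < 1 ->
  path_continuous u -> (forall t, `|u t| = 1) -> (forall t, u (t + p) = u t) ->
  exists s : R -> C, [/\ path_continuous s, forall t, s t ^+ 2 = 1 + w * u t,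
    forall t, s t != 0 & forall t, s (t + p) = s t].
Proof.
move=> w1 uc u1 up.
have re0 t : 0 < complex.Re (1 + w * u t).
  have : `|w * u t| < 1 by rewrite normrM u1 mulr1.
  case: (w * u t) => x y; rewrite normc_def /= ltcR => xy1.
  have : `|x| < 1.
    by apply: le_lt_trans xy1; rewrite -sqrtr_sqr ler_wsqrtr// lerDl sqr_ge0.
  by rewrite ltr_norml => /andP[]; lra.
have [||s [sc sE]] := @csqrt_lift R (fun t => 1 + w * u t) => //.
  apply: path_continuous_add; first exact: path_continuous_cst.
  by apply: path_continuous_mul => //; exact: path_continuous_cst.
have rs0 t : complex.Re (s t) != 0.
  have := re0 t; rewrite -sE; case: (s t) => x y; rewrite expr2 /=.
  by apply: contraTneq => ->;
    rewrite mul0r sub0r -expr2 oppr_gt0 -leNgt sqr_ge0.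
have [s1 _] := sc.
exists s; split=> // t.
  by apply: contra (rs0 t) => /eqP ->.
have /eqP : s (t + p) ^+ 2 = s t ^+ 2 by rewrite !sE up.
rewrite eqf_sqr => /orP[/eqP//|/eqP sN].
have sg a b : 0 < complex.Re (s a) -> 0 < complex.Re (s b).
  exact: (@nonvanishing_sign (fun u => complex.Re (s u)) a b s1 rs0).
have ReN : complex.Re (s (t + p)) = - complex.Re (s t).
  by rewrite sN; case: (s t).
have := rs0 t; rewrite neq_lt => /orP[st|st].
  have := sg (t + p) t; rewrite ReN oppr_gt0 => /(_ st) /(lt_trans st).
  by rewrite ltxx.
have := sg t (t + p) st; rewrite ReN oppr_gt0 => /(lt_trans st).
by rewrite ltxx.
Qed.

(** With z = X - e1 the equation is Y^2 = 4 z (z + e1 - e2) (z + e1 - e3).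
    On a small circle the last two factors are constants times 1 + w e^(2it)
    with |w| < 1; on a large one they are z times 1 + w e^(-2it) with
    |w| < 1.  The factors of the form 1 + w u have continuous roots of period
    pi, so Y^2 is the square of e^(it) or e^(3it) times a function of period
    pi, and Y changes sign after one turn. *)
Lemma separating_cycle_coordinates (e1 e2 : C) c : nonsingular e1 e2 ->
  separating_cycle e1 e2 c ->
  exists2 rho : R, 0 < rho &
  [/\ forall t, (c t).1 - e1 = rho%:C * cis (2%:R * t),
      forall t, (c t).2 ^+ 2 = 4%:R * (((c t).1 - e1) ^+ 3
        + 3%:R * e1 * ((c t).1 - e1) ^+ 2
        + (e1 - e2) * (2%:R * e1 + e2) * ((c t).1 - e1)),
      forall t, (c t).2 != 0,
      path_continuous (fun t => (c t).2) &
      forall t, (c (t + pi)).2 = - (c t).2].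
Proof.
move=> [e12 e13 _] [rho [rho0 sep cz cC Yc]].
exists rho => //.
have zE t : (c t).1 - e1 = rho%:C * cis (2%:R * t) by rewrite cz addrC addKr.
have Y2 t : (c t).2 ^+ 2 = 4%:R * (((c t).1 - e1) ^+ 3
        + 3%:R * e1 * ((c t).1 - e1) ^+ 2
        + (e1 - e2) * (2%:R * e1 + e2) * ((c t).1 - e1)).
  by rewrite cC /e3; ring.
have [W [Wc W0 WE Wp]] : exists W : R -> C, [/\ path_continuous W,
    forall t, W t != 0, forall t, (c t).2 ^+ 2 = W t ^+ 2 &
    forall t, W (t + pi) = - W t].
  have rC0 : rho%:C != 0 :> C by rewrite eq_complex /= eqxx andbT gt_eqF.
  have nrho : `|rho%:C| = rho%:C :> C by rewrite gtr0_norm// ltcR.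
  have cis2p t : cis (2%:R * (t + pi)) = cis (2%:R * t) :> C.
    by rewrite !cis_double cisDpi sqrrN.
  have cis2c : path_continuous (fun t : R => cis (2%:R * t)).
    rewrite (_ : (fun t : R => _) = fun t => cis t * cis t).
      by apply: path_continuous_mul; exact: path_continuous_cis.
    by apply/funext => t; rewrite cis_double.
  case: sep => -[r2 r3].
    have lift (e : C) : e1 != e -> rho%:C < `|e - e1| ->
        exists s : R -> C, [/\ path_continuous s,
          forall t, (e1 - e) * s t ^+ 2 = (c t).1 - e,
          forall t, s t != 0 & forall t, s (t + pi) = s t].
      move=> e1e re; have d0 : e1 - e != 0 by rewrite subr_eq0.
      have [||||s [sc sE s0 sp]] :=
        @unit_circle_sqrt (rho%:C / (e1 - e)) (fun t => cis (2%:R * t)) pi.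
      - rewrite normf_div nrho distrC ltr_pdivrMr ?mul1r//.
        by rewrite normr_gt0 subr_eq0 eq_sym.
      - exact: cis2c.
      - by move=> t; exact: normc_cis.
      - exact: cis2p.
      - exists s; split=> // t; rewrite sE cz; field.
        exact: d0.
    have [s2 [s2c s2E s20 s2p]] := lift _ e12 r2.
    have [s3 [s3c s3E s30 s3p]] := lift _ e13 r3.
    (* K is a square root of the constant factor of Y^2. *)
    pose K := 2%:R * sqrtc ((e1 - e2) * (e1 - e3 e1 e2) * rho%:C).
    have K0 : K != 0.
      rewrite mulf_neq0 ?pnatr_eq0// -sqrf_eq0 sqr_sqrtc.
      by rewrite !mulf_neq0// subr_eq0; [exact: e12|exact: e13].
    exists (fun t => K * (cis t * (s2 t * s3 t))); split.
    - apply: path_continuous_mul; first exact: path_continuous_cst.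
      apply: path_continuous_mul; first exact: path_continuous_cis.
      exact: path_continuous_mul.
    - move=> t; rewrite (mulf_neq0 K0)// (mulf_neq0 (cis_neq0 t))//.
      exact: mulf_neq0.
    - move=> t; rewrite cC -s2E -s3E zE cis_double !exprMn sqr_sqrtc; ring.
    - by move=> t; rewrite s2p s3p cisDpi mulNr mulrN.
  have lift (e : C) : `|e - e1| < rho%:C ->
      exists s : R -> C, [/\ path_continuous s,
        forall t, ((c t).1 - e1) * s t ^+ 2 = (c t).1 - e,
        forall t, s t != 0 & forall t, s (t + pi) = s t].
    move=> re.
    have [||||s [sc sE s0 sp]] :=
      @unit_circle_sqrt ((e1 - e) / rho%:C) (fun t => (cis (2%:R * t))^-1) pi.
    - rewrite normf_div nrho distrC ltr_pdivrMr ?mul1r//.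
      by rewrite ltcR.
    - by apply: path_continuous_inv => // t; exact: cis_neq0.
    - by move=> t; rewrite normfV normc_cis invr1.
    - by move=> t; rewrite cis2p.
    - exists s; split=> // t; rewrite sE zE cz; field.
      by rewrite cis_neq0 rC0.
  have [s2 [s2c s2E s20 s2p]] := lift _ r2.
  have [s3 [s3c s3E s30 s3p]] := lift _ r3.
  pose K := 2%:R * sqrtc (rho%:C ^+ 3).
  have K0 : K != 0.
    by rewrite mulf_neq0 ?pnatr_eq0// -sqrf_eq0 sqr_sqrtc expf_neq0.
  exists (fun t => K * (cis t * (cis t * cis t) * (s2 t * s3 t))); split.
  - apply: path_continuous_mul; first exact: path_continuous_cst.
    apply: path_continuous_mul; last exact: path_continuous_mul.
    apply: path_continuous_mul; first exact: path_continuous_cis.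
    by apply: path_continuous_mul; exact: path_continuous_cis.
  - by move=> t; rewrite (mulf_neq0 K0)// !mulf_neq0 ?cis_neq0.
  - move=> t; rewrite cC -s2E -s3E zE cis_double !exprMn sqr_sqrtc; ring.
  - by move=> t; rewrite s2p s3p cisDpi; ring.
have Y0 t : (c t).2 != 0 by rewrite -sqrf_eq0 WE sqrf_eq0.
split=> // t.
exact: (sqr_eq_antiperiodic Yc Wc W0 WE Wp).
Qed.
End Cycle.

(** * Integrals over the separating cycle *)

Section Contour.
Variable R : realType.
Local Notation C := R[i].
Local Notation I := (0 +i* 1 : C).

Lemma imag_neq0 : I != 0.
Proof. by rewrite eq_complex /= eqxx oner_eq0. Qed.

Lemma two_pi_gt0 : 0 < 2%:R * pi :> R.
Proof. by rewrite mulr_gt0// pi_gt0. Qed.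

Definition circle_pow (rho : R) (k : int) (t : R) : C :=
  (rho%:C * cis (2%:R * t)) ^ k.

Section CirclePow.
Variable rho : R.
Hypothesis rho0 : 0 < rho.
Local Notation zp := (circle_pow rho).

Lemma circle_neq0 t : rho%:C * cis (2%:R * t) != 0 :> C.
Proof. by rewrite mulf_neq0 ?cis_neq0// eq_complex /= eqxx andbT gt_eqF. Qed.

Lemma circle_powD k l t : zp (k + l) t = zp k t * zp l t.
Proof. by rewrite /circle_pow expfzDr// circle_neq0. Qed.

Lemma circle_powDpi k t : zp k (t + pi) = zp k t.
Proof. by rewrite /circle_pow !cis_double cisDpi sqrrN. Qed.

Lemma has_cder_circle_pow k t : has_cder (zp k) t (2%:R * k%:~R * I * zp k t).
Proof.
have zpE s : zp k s = rho%:C ^ k * cis (2%:R * k%:~R * s).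
  by rewrite /circle_pow expfzMl -cis_int; congr (_ * cis _); ring.
rewrite (_ : zp k = fun s => rho%:C ^ k * cis (2%:R * k%:~R * s)); last first.
  by apply/funext.
rewrite mulrCA.
have -> : 2%:R * k%:~R * I = 0 +i* (2%:R * k%:~R).
  rewrite -(rmorph_int (real_complex R)) -(rmorph_nat (real_complex R)).
  by apply/eqP; rewrite eq_complex /=; apply/andP; split; apply/eqP; ring.
exact: has_cderZ (has_cder_cis _ _).
Qed.

Lemma path_continuous_circle_pow k : path_continuous (zp k).
Proof.
by apply/path_continuousP => t;
  exact: has_cder_ccont_at (has_cder_circle_pow k t).
Qed.

(** For k <> 0 a primitive of z^k is z^k / (2ik), which takes equal values at
    both ends. *)
Lemma cint_circle_pow k :
  cint 0 (2%:R * pi) (zp k) = (k == 0)%:R * (2%:R * pi)%:C.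
Proof.
have [->|k0] := eqVneq k 0.
  rewrite (cint_FTC (H := fun t => t%:C) two_pi_gt0).
  - by rewrite mul1r subr0.
  - exact: path_continuous_circle_pow.
  - move=> t; exists (fun=> 1); split; last by [].
      by move=> s; rewrite mulr1 rmorphB.
    exact: ccont_at_cst.
have per : zp k (2%:R * pi) = zp k 0.
  have -> : 2%:R * pi = 0 + pi + pi :> R by ring.
  by rewrite !circle_powDpi.
have c0 : 2%:R * k%:~R * I != 0 :> C.
  apply: mulf_neq0 imag_neq0; apply: mulf_neq0; first by rewrite pnatr_eq0.
  by rewrite intr_eq0.
rewrite (cint_FTC (H := fun t => (2%:R * k%:~R * I)^-1 * zp k t) two_pi_gt0).
- by rewrite per subrr /= [RHS]mul0r.
- exact: path_continuous_circle_pow.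
- move=> t; have := has_cderZ (2%:R * k%:~R * I)^-1 (has_cder_circle_pow k t).
  by rewrite (mulKf c0).
Qed.

End CirclePow.

Lemma cintZ (c : C) (h : R -> C) (a b : R) : a < b -> path_continuous h ->
  cint a b (fun t => c * h t) = c * cint a b h.
Proof.
move=> ab hc; have c0 := @path_continuous_cst R 0.
have int0 : cint a b (fun=> 0 : C) = 0.
  rewrite (cint_FTC (H := fun=> 0) ab c0) ?subrr// => t.
  exists (fun=> 0); split=> //; first by move=> s; rewrite mulr0 subrr.
  exact: ccont_at_cst.
rewrite -[RHS]addr0 -[in RHS]int0 -cint_linear//; congr cint.
by apply/funext => t; rewrite addr0.
Qed.

Lemma contourE (c : R -> C * C) (F G : C * C -> C) (dG : R -> C) :
  (forall t, has_cder (fun s => G (c s)) t (dG t)) ->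
  contour c F G =
  (2%:R * pi%:C * I)^-1 * cint 0 (2%:R * pi) (fun t => F (c t) * dG t).
Proof.
move=> GdG; rewrite /contour; congr (_ * cint _ _ _); apply/funext => t.
by have [_ _ ->] := has_cder_is_derive (GdG t).
Qed.

Definition smooth_along (c : R -> C * C) (F : C * C -> C) : Prop :=
  exists2 dF : R -> C, path_continuous dF &
    forall t, has_cder (fun s => F (c s)) t (dF t).

Section OnCycle.
Variables (e1 e2 : C) (c : R -> C * C) (rho : R).
Local Notation a := (3%:R * e1).
Local Notation b := ((e1 - e2) * (2%:R * e1 + e2)).
Local Notation zp := (circle_pow rho).
Local Notation Y := (fun t => (c t).2).
Hypothesis rho0 : 0 < rho.
Hypothesis zE : forall t, (c t).1 - e1 = rho%:C * cis (2%:R * t).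
Hypothesis Y2 : forall t, (c t).2 ^+ 2 = 4%:R * (((c t).1 - e1) ^+ 3
        + a * ((c t).1 - e1) ^+ 2 + b * ((c t).1 - e1)).
Hypothesis Y0 : forall t, (c t).2 != 0.
Hypothesis Yc : path_continuous (fun t => (c t).2).
Hypothesis Yp : forall t, (c (t + pi)).2 = - (c t).2.

Definition cycle_cubic t := zp 3 t + a * zp 2 t + b * zp 1 t.
Definition cycle_cubic_der t :=
  I * (6%:R * zp 3 t + 4%:R * a * zp 2 t + 2%:R * b * zp 1 t).

Lemma cycle_Y_sqr t : (c t).2 ^+ 2 = 4%:R * cycle_cubic t.
Proof. by rewrite Y2 zE. Qed.

(** From Y Y' = (Y^2)' / 2; the coefficients 6, 4, 2 of the derivative of
    the cubic are 2j for z^j, as z turns with frequency 2. *)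
Lemma has_cder_cycle_Y t : has_cder Y t (2%:R * cycle_cubic_der t / (c t).2).
Proof.
have -> : 2%:R * cycle_cubic_der t / (c t).2 =
    4%:R * cycle_cubic_der t / (2%:R * (c t).2).
  by field; exact: Y0.
apply: (has_cder_sqrt Yc cycle_Y_sqr (Y0 t)).
apply: has_cderZ.
rewrite (_ : cycle_cubic_der t = 2%:R * 3%:~R * I * zp 3 t +
    a * (2%:R * 2%:~R * I * zp 2 t)
    + b * (2%:R * 1%:~R * I * zp 1 t)); last first.
  by rewrite /cycle_cubic_der; ring.
apply: has_cderD; last exact: has_cderZ (has_cder_circle_pow _ _ _).
apply: has_cderD; last exact: has_cderZ (has_cder_circle_pow _ _ _).
exact: has_cder_circle_pow.
Qed.

Definition cycle_basis n t : C :=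
  let k := (n %/ 2)%Z in
  if oddz n then 2%:R^-1 * ((c t).2 * zp (k - 1) t) else zp k t.

Definition cycle_basis_der n t : C :=
  let k := (n %/ 2)%Z in
  if oddz n then 2%:R^-1 * ((2%:R * cycle_cubic_der t / (c t).2) * zp (k - 1) t
     + (c t).2 * (2%:R * (k - 1)%:~R * I * zp (k - 1) t))
  else 2%:R * k%:~R * I * zp k t.

Lemma cycle_basisE n t : basis_fun e1 n (c t) = cycle_basis n t.
Proof.
by rewrite /basis_fun /cycle_basis zE; case: ifP => _; rewrite ?mulrA.
Qed.

Lemma has_cder_cycle_basis n t :
  has_cder (cycle_basis n) t (cycle_basis_der n t).
Proof.
rewrite /cycle_basis /cycle_basis_der /=; case: (oddz n).
  by apply: has_cderZ; apply: has_cderM;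
    [exact: has_cder_cycle_Y|exact: has_cder_circle_pow].
exact: has_cder_circle_pow.
Qed.

Lemma path_continuous_cycle_basis n : path_continuous (cycle_basis n).
Proof.
by apply/path_continuousP => t;
  exact: has_cder_ccont_at (has_cder_cycle_basis n t).
Qed.

Lemma path_continuous_cycle_basis_der n : path_continuous (cycle_basis_der n).
Proof.
have cst := @path_continuous_cst R.
have zc := path_continuous_circle_pow rho.
have cz z k : path_continuous (fun t => z * zp k t).
  exact: path_continuous_mul.
rewrite /cycle_basis_der /=; case: (oddz n); last exact: cz.
apply: path_continuous_mul => //; apply: path_continuous_add.
  apply: (path_continuous_mul _ (zc _)).
  apply: path_continuous_mul; last exact: path_continuous_inv.
  apply: path_continuous_mul => //; apply: path_continuous_mul => //.
  by do 2 apply: path_continuous_add => //.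
exact: path_continuous_mul.
Qed.

Lemma cycle_basisDpi n t : cycle_basis n (t + pi) =
  if oddz n then - cycle_basis n t else cycle_basis n t.
Proof.
rewrite /cycle_basis /=; case: (oddz n); last by rewrite circle_powDpi.
by rewrite circle_powDpi Yp mulNr mulrN.
Qed.

Lemma cycle_basis_derDpi n t : cycle_basis_der n (t + pi) =
  if oddz n then - cycle_basis_der n t else cycle_basis_der n t.
Proof.
rewrite /cycle_basis_der /cycle_cubic_der /=; case: (oddz n);
  last by rewrite circle_powDpi.
by rewrite !circle_powDpi Yp invrN mulrN !mulNr -opprD mulrN.
Qed.

(** For n and m of different parity the integrand is antiperiodic.  For equal
    parities it is a Laurent polynomial in z, whose terms are integrated by
    [cint_circle_pow]. *)
Lemma contour_basis n m :
  contour c (basis_fun e1 n) (basis_fun e1 m) = pairing e1 e2 n m.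
Proof.
have fE k : (fun t => basis_fun e1 k (c t)) = cycle_basis k.
  by apply/funext => t; exact: cycle_basisE.
rewrite (@contourE _ _ _ (cycle_basis_der m)); last first.
  by move=> t; rewrite fE; exact: has_cder_cycle_basis.
rewrite (_ : (fun t => _) = fun t =>
    cycle_basis n t * cycle_basis_der m t); last first.
  by apply/funext => t; rewrite cycle_basisE.
have pi_neq : pi%:C != 0 :> C.
  by rewrite eq_complex /= eqxx andbT gt_eqF// pi_gt0.
have [nm|nm] := eqVneq (oddz n) (oddz m); last first.
  rewrite cint_antiperiodic ?mulr0 /pairing ?nm ?pi_gt0//.
    by apply: path_continuous_mul; [exact: path_continuous_cycle_basis|
      exact: path_continuous_cycle_basis_der].
  move=> t; rewrite cycle_basisDpi cycle_basis_derDpi.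
  by case: (oddz n) (oddz m) nm => [] [] //= _; rewrite ?mulNr ?mulrN.
have piC : (2%:R * pi)%:C = 2%:R * pi%:C :> C by rewrite rmorphM rmorph_nat.
have [hn hm] := (oddz_eq n, oddz_eq m).
pose k := (n %/ 2)%Z; pose l := (m %/ 2)%Z.
have zc j := path_continuous_circle_pow rho j.
have cz z j : path_continuous (fun t => z * zp j t).
  by apply: path_continuous_mul => //; exact: path_continuous_cst.
rewrite pairing_sumE nm eqxx /=.
have [om|om] := boolP (oddz m); last first.
  have nE : n = 2 * k by rewrite hn nm (negbTE om) addr0.
  have mE : m = 2 * l by rewrite hm (negbTE om) addr0.
  rewrite (_ : (fun t => _) = fun t =>
      2%:R * l%:~R * I * zp (k + l) t); last first.
    apply/funext => t; rewrite /cycle_basis /cycle_basis_der /= nm (negbTE om).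
    by rewrite circle_powD// mulrCA.
  rewrite (cintZ _ two_pi_gt0 (zc _)) cint_circle_pow// piC.
  rewrite (_ : (n + m == 0) = (k + l == 0)); last by rewrite nE mE; lia.
  have [kl|_] := eqVneq (k + l) 0; last by rewrite mul0r !mulr0.
  have -> : l = - k by lia.
  rewrite nE !rmorphM rmorphN /=; move: (pi%:C : C) pi_neq => P P0; field.
  by rewrite imag_neq0 P0.
have nE : n = 2 * k + 1 by rewrite hn nm om.
have mE : m = 2 * l + 1 by rewrite hm om.
rewrite (_ : (fun t => _) = fun t => (I * (2%:R * l%:~R + 1)) * zp (k + l + 1) t
  + ((I * a * (2%:R * l%:~R)) * zp (k + l) t
  + (I * b * (2%:R * l%:~R - 1)) * zp (k + l - 1) t)); last first.
  apply/funext => t; rewrite /cycle_basis /cycle_basis_der /= nm om -/k -/l.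
  rewrite (_ : k + l + 1 = (k - 1) + ((l - 1) + 3)); last by ring.
  rewrite (_ : k + l = (k - 1) + ((l - 1) + 2)); last by ring.
  rewrite (_ : k - 1 + (l - 1 + 2) - 1 = (k - 1) + ((l - 1) + 1)); last by ring.
  rewrite !(circle_powD rho0 (k - 1)) !(circle_powD rho0 (l - 1)).
  transitivity (zp (k - 1) t * zp (l - 1) t *
    (2%:R^-1 * cycle_cubic_der t
     + 4%:R^-1 * (c t).2 ^+ 2 * (2%:R * (l - 1)%:~R * I))).
    by field; exact: Y0.
  by rewrite cycle_Y_sqr /cycle_cubic /cycle_cubic_der rmorphB /=; field.
rewrite (cint_linear _ _ _ (zc _)); last by apply: path_continuous_add.
rewrite (cint_linear _ _ _ (zc _))// (cintZ _ two_pi_gt0 (zc _)).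
rewrite !cint_circle_pow// piC.
rewrite (_ : (k + l + 1 == 0) = (n + m == 0)); last by rewrite nE mE; lia.
rewrite (_ : (k + l == 0) = (n + m == 2)); last by rewrite nE mE; lia.
rewrite (_ : (k + l - 1 == 0) = (n + m == 4)); last by rewrite nE mE; lia.
have -> : l%:~R = (m%:~R - 1) / 2%:R :> C.
  by rewrite mE rmorphD rmorphM /=; field.
have sE j : n + m = j -> m%:~R = j%:~R - n%:~R :> C.
  by move=> <-; rewrite rmorphD /= addrC addKr.
move: (pi%:C : C) pi_neq => P P0; rewrite !rmorphD !rmorphN /=.
case: (n + m =P 0) => [s|_]; last case: (n + m =P 2) => [s|_];
  last case: (n + m =P 4) => [s|_]; rewrite ?s ?(sE _ s) /=; field;
  by rewrite imag_neq0 P0.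
Qed.

Lemma cycle_basis_smooth n : smooth_along c (basis_fun e1 n).
Proof.
exists (cycle_basis_der n); first exact: path_continuous_cycle_basis_der.
move=> t; rewrite (_ : (fun s => _) = cycle_basis n).
  exact: has_cder_cycle_basis.
by apply/funext => s; exact: cycle_basisE.
Qed.

End OnCycle.
End Contour.

(** * The geometric cocycle *)

Section GeometricCocycle.
Variable R : realType.
Local Notation C := R[i].

Lemma smooth_along_cont (c : R -> C * C) F :
  smooth_along c F -> path_continuous (fun t => F (c t)).
Proof.
by move=> [dF _ FdF]; apply/path_continuousP => t;
  exact: has_cder_ccont_at (FdF t).
Qed.

Lemma smooth_along_lin (c : R -> C * C) (r : C) F G :
  smooth_along c F -> smooth_along c G ->
  smooth_along c (fun Q => r * F Q + G Q).
Proof.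
move=> [dF cF FdF] [dG cG GdG]; exists (fun t => r * dF t + dG t).
  apply: path_continuous_add => //; apply: path_continuous_mul => //.
  exact: path_continuous_cst.
by move=> t; apply: has_cderD => //; exact: has_cderZ.
Qed.

Lemma contour_lin_l (c : R -> C * C) (r : C) F F' G :
  smooth_along c F -> smooth_along c F' -> smooth_along c G ->
  contour c (fun Q => r * F Q + F' Q) G = r * contour c F G + contour c F' G.
Proof.
move=> sF sF' [dG cG GdG]; rewrite !(contourE _ GdG).
rewrite [r * (_ * _)]mulrCA -mulrDr; congr (_ * _).
rewrite -cint_linear; last 2 first.
- by apply: path_continuous_mul => //; exact: smooth_along_cont.
- by apply: path_continuous_mul => //; exact: smooth_along_cont.
by congr cint; apply/funext => t; rewrite mulrDl mulrA.
Qed.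

Lemma contour_lin_r (c : R -> C * C) (r : C) F G G' :
  smooth_along c F -> smooth_along c G -> smooth_along c G' ->
  contour c F (fun Q => r * G Q + G' Q) = r * contour c F G + contour c F G'.
Proof.
move=> sF [dG cG GdG] [dG' cG' GdG'].
rewrite (contourE _ GdG) (contourE _ GdG').
rewrite (@contourE _ _ _ _ (fun t => r * dG t + dG' t)); last first.
  by move=> t; apply: has_cderD => //; exact: has_cderZ.
rewrite [r * (_ * _)]mulrCA -mulrDr; congr (_ * _).
rewrite -cint_linear; last 2 first.
- by apply: path_continuous_mul => //; exact: smooth_along_cont.
- by apply: path_continuous_mul => //; exact: smooth_along_cont.
by congr cint; apply/funext => t; rewrite mulrDr mulrCA.
Qed.

Lemma alg_funE (e1 : C) (a : finfam C^o) A Q : supported a A ->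
  alg_fun e1 a Q = \sum_(n <- A) a n * basis_fun e1 n Q.
Proof.
by move=> sa; rewrite /alg_fun (@fsbigTE _ _ _ _ A)// => n /sa ->;
  rewrite mul0r.
Qed.

Lemma alg_fun_lin (e1 : C) r (a b : finfam C^o) :
  alg_fun e1 (r *: a + b) = fun Q => r * alg_fun e1 a Q + alg_fun e1 b Q.
Proof.
apply/funext => Q.
have [A sa] := supported_ex a; have [B sb] := supported_ex b.
have sa' : supported a (A `|` B)%fset by apply: supportedU; left.
have sb' : supported b (A `|` B)%fset by apply: supportedU; right.
rewrite (alg_funE _ _ (supported_lin r sa' sb')).
rewrite (alg_funE _ _ sa') (alg_funE _ _ sb').
rewrite mulr_sumr -big_split; apply: eq_bigr => n _.
by rewrite -[(r *: a + b) n]/(r * a n + b n) mulrDl mulrA.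
Qed.

Lemma alg_fun_single1 (e1 : C) n :
  alg_fun e1 (single (1 : C^o) n) = basis_fun e1 n.
Proof.
apply/funext => Q; rewrite (alg_funE _ _ (@single_supported _ C^o 1 n)).
by rewrite big_seq_fset1 singleE eqxx mul1r.
Qed.

Lemma smooth_along_alg_fun (e1 : C) (c : R -> C * C) (a : finfam C^o) :
  (forall n, smooth_along c (basis_fun e1 n)) -> smooth_along c (alg_fun e1 a).
Proof.
move=> sb; have [A sA] := supported_ex a.
rewrite (_ : alg_fun e1 a = fun Q =>
    \sum_(n <- A) a n * basis_fun e1 n Q); last first.
  by apply/funext => Q; exact: alg_funE.
elim: (A : seq int) => [|n s ih].
  exists (fun=> 0); first exact: path_continuous_cst.
  move=> t; exists (fun=> 0); split=> //; last exact: ccont_at_cst.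
  by move=> s; rewrite !big_nil mulr0 subrr.
rewrite (_ : (fun Q => _) = fun Q => a n * basis_fun e1 n Q
    + \sum_(k <- s) a k * basis_fun e1 k Q); last first.
  by apply/funext => Q; rewrite big_cons.
exact: smooth_along_lin.
Qed.

Lemma separating_cycle_contour (e1 e2 : C) cyc : nonsingular e1 e2 ->
  separating_cycle e1 e2 cyc ->
  (forall n, smooth_along cyc (basis_fun e1 n)) /\
  (forall n m,
     contour cyc (basis_fun e1 n) (basis_fun e1 m) = pairing e1 e2 n m).
Proof.
move=> ns /(separating_cycle_coordinates ns)[rho rho0 [zE Y2 Y0 Yc Yp]];
  split=> [n|n m].
  exact: (cycle_basis_smooth zE Y2 Y0 Yc).
exact: (contour_basis rho0 zE Y2 Y0 Yc Yp).
Qed.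

Variables (g : vectType C) (beta : g -> g -> C^o).
Hypothesis betaB : bilinear_map beta.

Lemma tensor_linear (x : g) : linear (tensor x).
Proof.
move=> r a b; apply: finfamP => n.
rewrite -[RHS]/(r *: (a n *: x) + b n *: x) -[LHS]/((r * a n + b n) *: x).
by rewrite scalerDl scalerA.
Qed.

Lemma tensor_single (x : g) (r : C) n :
  tensor x (single (r : C^o) n) = single (r *: x) n.
Proof.
apply: finfamP => k; rewrite -[LHS]/((single (r : C^o) n k) *: x) !singleE.
by case: eqP => // _; rewrite scale0r.
Qed.

Lemma eval2_1 (e1 e2 : C) : eval2 1 e1 e2 = 1.
Proof. by rewrite /eval2 !hornerE. Qed.

Lemma cocycle_scale p e1 e2 u v :
  cocycle beta p e1 e2 u v = eval2 p e1 e2 * cocycle beta 1 e1 e2 u v.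
Proof.
pose h u v : C^o := eval2 p e1 e2 * cocycle beta 1 e1 e2 u v.
apply: (bilinear_ext (h := h)) u v; rewrite /h.
- exact: cocycle_bilinear.
- have [c1 c2] := cocycle_bilinear betaB 1 e1 e2.
  split=> w r x y; rewrite ?c2 ?c1 mulrDr; congr (_ + _).
    by rewrite -[_ *: _]/(r * _) mulrCA.
  by rewrite -[_ *: _]/(r * _) mulrCA.
- by move=> x n y m; rewrite !cocycle_single// eval2_1 mul1r mulrA.
Qed.

(** Both sides are bilinear in the two functions, so it is enough that they
    agree on the functions A_n. *)
Lemma cocycle_geometric e1 e2 : nonsingular e1 e2 ->
  geometric_cocycle beta e1 e2 (cocycle beta 1 e1 e2).
Proof.
move=> ns; split; first exact: cocycle_bilinear.
move=> cyc /(separating_cycle_contour ns)[sb cE] x y a b.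
have sa w := @smooth_along_alg_fun e1 cyc w sb.
have [c1 c2] := cocycle_bilinear betaB 1 e1 e2.
pose f a b : C^o := cocycle beta 1 e1 e2 (tensor x a) (tensor y b).
pose h a b : C^o := beta x y * contour cyc (alg_fun e1 a) (alg_fun e1 b).
rewrite -[LHS]/(f a b) -[RHS]/(h a b); apply: bilinear_ext1; rewrite /f /h.
- by split=> w r u v; rewrite tensor_linear ?c1 ?c2.
- split=> w r u v; rewrite alg_fun_lin.
    by rewrite contour_lin_l// mulrDr mulrCA.
  by rewrite contour_lin_r// mulrDr mulrCA.
- move=> n m; rewrite !tensor_single !alg_fun_single1 cocycle_single// cE.
  by rewrite !scale1r eval2_1 mul1r.
Qed.

(** A separating cycle exists, so the values of a geometric cocycle are
    prescribed on the x (x) A_n, which span. *)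
Lemma geometric_cocycle_unique e1 e2 c c' : nonsingular e1 e2 ->
  geometric_cocycle beta e1 e2 c -> geometric_cocycle beta e1 e2 c' -> c = c'.
Proof.
move=> ns [bc gc] [bc' gc']; apply/funext => u; apply/funext => v.
have [cyc sc] := separating_cycle_exists ns.
apply: bilinear_ext => // x n y m.
by rewrite -(scale1r x) -(scale1r y) -!tensor_single (gc _ sc) (gc' _ sc).
Qed.

End GeometricCocycle.

(** * The family of higher genus affine algebras *)

Theorem theorem4p9 (R : realType) (g : vectType R[i]) (lb : g -> g -> g)
    (beta : g -> g -> R[i]^o) :
  lie_algebra lb ->
  bilinear_map beta -> lie_symmetric beta -> lie_invariant lb beta ->
  [/\ (* gamma is p times the geometric two-cocycle ... *)
      forall e1 e2 : R[i], nonsingular e1 e2 ->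
        exists c : finfam g -> finfam g -> R[i]^o,
          [/\ unique (geometric_cocycle beta e1 e2) c,
              two_cocycle (current_bracket lb e1 e2) c &
              forall p u v, cocycle beta p e1 e2 u v = eval2 p e1 e2 * c u v],
      (* ... whose contour integrals are given by the displayed formula *)
      forall e1 e2 : R[i], nonsingular e1 e2 ->
        forall cyc, separating_cycle e1 e2 cyc -> forall n m : int,
          contour cyc (basis_fun e1 n) (basis_fun e1 m) = pairing e1 e2 n m,
      forall p (e1 e2 : R[i]) (x y : g) (n m : int),
        cocycle beta p e1 e2 (single x n) (single y m) =
        eval2 p e1 e2 * beta x y * pairing e1 e2 n m,
      (* almost-graded central extensions, for all parameters *)
      forall p (e1 e2 : R[i]),
        [/\ lie_algebra (current_bracket lb e1 e2),
            two_cocycle (current_bracket lb e1 e2) (cocycle beta p e1 e2),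
            lie_algebra (family_bracket lb beta p e1 e2),
            central (family_bracket lb beta p e1 e2) (central_elt (finfam g)) &
            forall d : int,
              almost_graded (family_bracket lb beta p e1 e2)
                (@ext_degree R g d)] &
      (* the special element *)
      [/\ forall u v : finfam g,
            current_bracket lb 0 0 u v = classical_current_bracket lb u v,
          forall p, eval2 p 0 0 = 1 -> forall a b : R[i]^o * finfam g,
            family_bracket lb beta p 0 0 a b =
            classical_affine_bracket lb beta a b &
          forall p, eval2 p 0 0 != 0 ->
            exists phi : R[i]^o * finfam g -> R[i]^o * finfam g,
              lie_isomorphism (family_bracket lb beta p 0 0)
                (classical_affine_bracket lb beta) phi /\
              forall w, (phi w).2 = w.2]].
Proof.
move=> lbL betaB betaS betaI; split.
- move=> e1 e2 ns; exists (cocycle beta 1 e1 e2); split.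
  + split; first exact: cocycle_geometric.
    move=> c; exact: geometric_cocycle_unique ns (cocycle_geometric betaB ns).
  + exact: cocycle_two_cocycle.
  + by move=> p u v; exact: cocycle_scale.
- by move=> e1 e2 ns cyc sc; have [_] := separating_cycle_contour ns sc.
- by move=> p e1 e2 x y n m; exact: cocycle_single.
- move=> p e1 e2; have brL := current_bracket_lie e1 e2 lbL.
  have cC := cocycle_two_cocycle lbL betaB betaS betaI p e1 e2.
  split=> //; first exact: ext_bracket_lie.
    by apply: ext_bracket_central; [case: brL|case: cC].
  by move=> d; exact: family_almost_graded.
- split=> [u v|p p1 a b|p p0]; first exact: current_bracket00.
    rewrite /family_bracket /classical_affine_bracket /ext_bracket.
    by rewrite cocycle00// p1 mul1r current_bracket00.
  exact: family_special_isom.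
Qed.
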